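(* Let $\mathbf k$ be a field and $\vec\alpha=(\alpha^{(1)},\dots,\alpha^{(\ell)})$ a sequence of compositions with $|\alpha^{(1)}|+\dots+|\alpha^{(\ell)}|=n$. Then the sequence $(\mathcal C(\vec\alpha),\partial)$ defined below is a cochain complex of $\mathcal H_n(0)$-modules which is acyclic in strictly positive cohomological degrees, and \[H^0(\mathcal C(\vec\alpha))\cong\mathbf P_{\alpha^{(1)}\cdot\alpha^{(2)}\cdots\alpha^{(\ell)}}.\]
   Context: For $N\ge0$, $\mathcal H_N(0)$ is the $\mathbf k$-algebra generated by $\pi_1,\dots,\pi_{N-1}$ with $\pi_i^2=\pi_i$, $\pi_i\pi_{i+1}\pi_i=\pi_{i+1}\pi_i\pi_{i+1}$, $\pi_i\pi_j=\pi_j\pi_i$ for $|i-j|>1$; $\bar\pi_i=\pi_i-1$. A composition $\alpha=(\alpha_1,\dots,\alpha_k)\vDash n$ is a sequence of positive integers with sum $n$. The ribbon $\mathrm{Diag}(\alpha)$ is the connected diagram with $k$ rows, the $i$-th row from the bottom having $\alpha_i$ boxes, the leftmost box of row $i+1$ lying directly above the rightmost box of row $i$. For a sequence of compositions $\vec\gamma=(\gamma^{(1)},\dots,\gamma^{(s)})$, the generalized ribbon $\mathrm{Diag}(\vec\gamma)$ is the disjoint union of the ribbons $\mathrm{Diag}(\gamma^{(j)})$, placed so that for each $j$ the southwesternmost box of the $(j+1)$-st component lies one row above and one column to the right of the northeasternmost box of the $j$-th component. For a finite diagram $D$ of $N$ boxes, a standard tableau of shape $D$ is a bijective filling by $1,\dots,N$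 strictly increasing left to right between horizontally adjacent boxes and strictly increasing top to bottom between vertically adjacent boxes. $\mathbf P_D$ is the $\mathbf k$-space with basis the standard tableaux of shape $D$ and $\mathcal H_N(0)$-action $\bar\pi_iT=-T$ if $i$ is in a higher row than $i+1$, $0$ if in the same row, $s_i(T)$ (swap $i,i+1$) if $i$ is in a lower row. Write $\mathbf P_{\vec\gamma}=\mathbf P_{\mathrm{Diag}(\vec\gamma)}$ and $\mathbf P_\alpha=\mathbf P_{\mathrm{Diag}(\alpha)}$. Concatenation $\alpha\cdot\beta=(\alpha_1,\dots,\alpha_\ell,\beta_1,\dots,\beta_r)$; near-concatenation $\alpha\odot\beta=(\alpha_1,\dots,\alpha_{\ell-1},\alpha_\ell+\beta_1,\beta_2,\dots,\beta_r)$. Geometrically $\mathrm{Diag}(\alpha\odot\beta)$ arises from the two-component $\mathrm{Diag}(\alpha,\beta)$ by translating the $\beta$-component one unit down, so that the northeasternmost box of the $\alpha$-part is immediately left of the southwesternmost box of the $\beta$-part. For $I\subseteq[\ell-1]$, $\vec\alpha(I)$ is the sequence of $\ell-|I|$ compositions obtained from $\vec\alpha$ by replacing, for each $i\in I$, the $i$-th comma (between $\alpha^{(i)}$ and $\alpha^{(i+1)}$) by $\odot$. Set $\mathcal C_i(\vec\alpha)=\bigoplus_{I\subseteq[\ell-1],|I|=i}\mathbf P_{\vec\alpha(I)}$ (in cohomological degree $i$). For $j\in[\ell-1]\setminus I$ and a standard tableau $T$ of shape $\mathrm{Diag}(\vec\alpha(I))$, let $\phi_j(T)\in\mathbf P_{\vec\alpha(I\cup\{j\})}$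 be the filling obtained by gluing the two components separated by the $j$-th comma via near-concatenation (the entries of each box kept, the other components unchanged), if that filling is standard, and $0$ otherwise. With $I=\{i_1<\dots<i_r\}$ and $\mathrm{sgn}(j,I)=(-1)^{\#\{t:i_t<j\}}$, define $\partial_i:\mathcal C_i(\vec\alpha)\to\mathcal C_{i+1}(\vec\alpha)$ by $\partial_i(T)=\sum_{j\in[\ell-1]\setminus I}\mathrm{sgn}(j,I)\phi_j(T)$ for $T\in\mathbf P_{\vec\alpha(I)}$. *)

(* Defs.v *)
From HB Require Import structures.
From mathcomp Require Import all_boot all_order all_algebra all_fingroup.
From mathcomp Require Import boolp zify.
From mathcomp Require Import finmap monalg generic_quotient ring_quotient.

Set Implicit Arguments.
Unset Strict Implicit.
Unset Printing Implicit Defensive.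

Import GRing.Theory.
Local Open Scope ring_scope.
Local Open Scope quotient_scope.

Record submodule (R : pzRingType) (V : lmodType R) := Submodule {
  in_submod :> V -> Prop;
  in_submod0 : in_submod 0;
  in_submodZD : forall a u v, in_submod u -> in_submod v -> in_submod (a *: u + v)
}.

Section SubQuotient.
Variables (R : pzRingType) (V : lmodType R) (S : submodule V).

Definition submod_pred : {pred V} := fun x => `[< S x >].

Fact submod_pred_closed : submod_closed submod_pred.
Proof.
split; first by apply/asboolP; apply: in_submod0.
by move=> a u v /asboolP Su /asboolP Sv; apply/asboolP/in_submodZD.
Qed.

HB.instance Definition _ := GRing.isSubmodClosed.Build R V submod_pred
  submod_pred_closed.

Definition submod := {x : V | x \in submod_pred}.
HB.instance Definition _ := SubType.on submod.
HB.instance Definition _ := Choice.on submod.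
HB.instance Definition _ := [SubChoice_isSubLmodule of submod by <:].

Definition quotmod := Quotient.quot submod_pred.
HB.instance Definition _ := EqQuotient.on quotmod.
HB.instance Definition _ := GRing.Zmodule.on quotmod.

Lemma quotmodP (x y : V) :
  reflect (S (x - y)) (\pi_quotmod x == \pi_quotmod y).
Proof. by rewrite -Quotient.idealrBE; apply: asboolP. Qed.

Lemma quotmod_piD : {morph \pi_quotmod : x y / x + y}.
Proof. exact: Quotient.pi_add. Qed.

Definition quotmod_scale a (x : quotmod) : quotmod :=
  \pi_quotmod (a *: repr x).

Lemma quotmod_pi_scale a (x : V) :
  quotmod_scale a (\pi_quotmod x) = \pi_quotmod (a *: x).
Proof.
apply/eqP/quotmodP; rewrite -scalerBr -[_ *: _]addr0.
apply: in_submodZD; last exact: in_submod0.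
by apply/quotmodP; apply/eqP; rewrite reprK.
Qed.

Fact quotmod_scaleA a b x :
  quotmod_scale a (quotmod_scale b x) = quotmod_scale (a * b) x.
Proof.
elim/quotW: x => x.
by rewrite [quotmod_scale b _]quotmod_pi_scale !quotmod_pi_scale scalerA.
Qed.
Fact quotmod_scale1 : left_id 1 quotmod_scale.
Proof. by move=> x; rewrite -[x]reprK quotmod_pi_scale scale1r. Qed.
Fact quotmod_scaleDr : right_distributive quotmod_scale +%R.
Proof.
move=> a x y; rewrite -[x]reprK -[y]reprK -quotmod_piD !quotmod_pi_scale.
by rewrite scalerDr quotmod_piD.
Qed.
Fact quotmod_scaleDl x : {morph quotmod_scale^~ x : a b / a + b}.
Proof.
by move=> a b; rewrite -[x]reprK !quotmod_pi_scale scalerDl quotmod_piD.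
Qed.
HB.instance Definition _ := GRing.Zmodule_isLmodule.Build R quotmod
  quotmod_scaleA quotmod_scale1 quotmod_scaleDr quotmod_scaleDl.

End SubQuotient.

Record cochain_complex (R : pzRingType) := CochainComplex {
  cochain :> nat -> lmodType R;
  codiff : forall i, cochain i -> cochain i.+1;
  codiff_linear : forall i, linear (@codiff i);
  codiffK : forall i x, codiff (@codiff i x) = 0
}.

Section Cohomology.
Variables (R : pzRingType) (C : cochain_complex R) (i : nat).

HB.instance Definition _ j :=
  GRing.isLinear.Build R (C j) (C j.+1) *:%R (@codiff R C j) (@codiff_linear R C j).

Fact cocycle0 : codiff (0 : C i) = 0.
Proof. exact: linear0. Qed.
Fact cocycleZD a (u v : C i) : codiff u = 0 -> codiff v = 0 ->
  codiff (a *: u + v) = 0.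
Proof. by move=> du dv; rewrite codiff_linear du dv scaler0 addr0. Qed.

Definition cocycles : submodule (C i) :=
  @Submodule R (C i) (fun x => codiff x = 0) cocycle0 cocycleZD.

(* the module in degree -1 is zero *)
Definition is_coboundary : C i -> Prop :=
  match i with
  | 0 => fun x => x = 0
  | j.+1 => fun x => exists y : C j, x = codiff y
  end.

Lemma is_coboundary0 : is_coboundary 0.
Proof. by rewrite /is_coboundary; case: i => [|j] //; exists 0; rewrite linear0. Qed.
Lemma is_coboundaryZD a x y :
  is_coboundary x -> is_coboundary y -> is_coboundary (a *: x + y).
Proof.
move: x y; rewrite /is_coboundary.
case: i => [|j] x y; first by move=> -> ->; rewrite scaler0 addr0.
by move=> [x' ->] [y' ->]; exists (a *: x' + y'); rewrite codiff_linear.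
Qed.

Fact coboundary0 : is_coboundary (val (0 : submod cocycles)).
Proof. by rewrite raddf0; apply: is_coboundary0. Qed.
Fact coboundaryZD a (u v : submod cocycles) :
  is_coboundary (val u) -> is_coboundary (val v) ->
  is_coboundary (val (a *: u + v)).
Proof. by rewrite linearP; apply: is_coboundaryZD. Qed.

Definition coboundaries : submodule (submod cocycles) :=
  @Submodule R (submod cocycles) (fun x => is_coboundary (val x))
    coboundary0 coboundaryZD.

Definition cohomology : lmodType R := quotmod coboundaries.

End Cohomology.

Section DirectSum.
Variables (R : pzRingType) (I : finType) (M : I -> lmodType R).

Definition dsum := {dffun forall i, M i}.
HB.instance Definition _ := Choice.on dsum.

Definition dsum_of (f : forall i, M i) : dsum := [ffun i => f i].
Definition dsum0 : dsum := dsum_of (fun i => 0).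
Definition dsum_opp (x : dsum) : dsum := dsum_of (fun i => - x i).
Definition dsum_add (x y : dsum) : dsum := dsum_of (fun i => x i + y i).
Definition dsum_scale a (x : dsum) : dsum := dsum_of (fun i => a *: x i).

Fact dsum_addA : associative dsum_add.
Proof. by move=> x y z; apply/ffunP => i; rewrite !ffunE addrA. Qed.
Fact dsum_addC : commutative dsum_add.
Proof. by move=> x y; apply/ffunP => i; rewrite !ffunE addrC. Qed.
Fact dsum_add0 : left_id dsum0 dsum_add.
Proof. by move=> x; apply/ffunP => i; rewrite !ffunE add0r. Qed.
Fact dsum_addN : left_inverse dsum0 dsum_opp dsum_add.
Proof. by move=> x; apply/ffunP => i; rewrite !ffunE addNr. Qed.
HB.instance Definition _ := GRing.isZmodule.Build dsum
  dsum_addA dsum_addC dsum_add0 dsum_addN.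

Fact dsum_scaleA a b x : dsum_scale a (dsum_scale b x) = dsum_scale (a * b) x.
Proof. by apply/ffunP => i; rewrite !ffunE scalerA. Qed.
Fact dsum_scale1 : left_id 1 dsum_scale.
Proof. by move=> x; apply/ffunP => i; rewrite !ffunE scale1r. Qed.
Fact dsum_scaleDr : right_distributive dsum_scale +%R.
Proof. by move=> a x y; apply/ffunP => i; rewrite !ffunE scalerDr. Qed.
Fact dsum_scaleDl x : {morph dsum_scale^~ x : a b / a + b}.
Proof. by move=> a b; apply/ffunP => i; rewrite !ffunE scalerDl. Qed.
HB.instance Definition _ := GRing.Zmodule_isLmodule.Build R dsum
  dsum_scaleA dsum_scale1 dsum_scaleDr dsum_scaleDl.

End DirectSum.

Section ZeroHecke.
Variables (k : fieldType) (n : nat).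

(* The index i : 'I_n.-1 stands for the subscript i + 1. *)
Local Notation free_hecke := {malg k[{fmonom 'I_n.-1}]}.

Definition free_gen (i : 'I_n.-1) : free_hecke := << fmu i >>.

Inductive hecke_rel : free_hecke -> Prop :=
| hecke_idem i : hecke_rel (free_gen i * free_gen i - free_gen i)
| hecke_braid (i j : 'I_n.-1) : j = i.+1 :> nat ->
    hecke_rel (free_gen i * free_gen j * free_gen i
               - free_gen j * free_gen i * free_gen j)
| hecke_comm (i j : 'I_n.-1) : (i.+1 < j)%N || (j.+1 < i)%N ->
    hecke_rel (free_gen i * free_gen j - free_gen j * free_gen i).

Inductive hecke_ideal_spec : free_hecke -> Prop :=
| hecke_ideal0 : hecke_ideal_spec 0
| hecke_ideal_gen x : hecke_rel x -> hecke_ideal_spec x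
| hecke_idealD x y : hecke_ideal_spec x -> hecke_ideal_spec y ->
    hecke_ideal_spec (x + y)
| hecke_idealMl a x : hecke_ideal_spec x -> hecke_ideal_spec (a * x)
| hecke_idealMr a x : hecke_ideal_spec x -> hecke_ideal_spec (x * a).

Fact hecke_idealZD (c : k) x y : hecke_ideal_spec x -> hecke_ideal_spec y ->
  hecke_ideal_spec (c *: x + y).
Proof.
by move=> Ix Iy; rewrite -mul_malgC; apply: hecke_idealD; first apply: hecke_idealMl.
Qed.

Definition hecke_ideal : submodule free_hecke :=
  @Submodule k free_hecke hecke_ideal_spec hecke_ideal0 hecke_idealZD.

Definition hecke := quotmod hecke_ideal.
HB.instance Definition _ := EqQuotient.on hecke.
HB.instance Definition _ := GRing.Lmodule.on hecke.

Definition hecke_one : hecke := \pi_hecke 1.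
Definition hecke_mul (x y : hecke) : hecke := \pi_hecke (repr x * repr y).

Lemma hecke_pi_mul x y :
  hecke_mul (\pi_hecke x) (\pi_hecke y) = \pi_hecke (x * y).
Proof.
apply/eqP/(@quotmodP _ _ hecke_ideal).
set x' := repr _; set y' := repr _.
have -> : x' * y' - x * y = (x' - x) * y' + x * (y' - y).
  by rewrite mulrBl mulrBr addrA subrK.
apply: hecke_idealD.
  by apply: hecke_idealMr; apply/(@quotmodP _ _ hecke_ideal)/eqP; rewrite reprK.
by apply: hecke_idealMl; apply/(@quotmodP _ _ hecke_ideal)/eqP; rewrite reprK.
Qed.

Lemma hecke_ideal_mcoeff1 x :
  hecke_ideal_spec x -> mcoeff (mone : {fmonom 'I_n.-1}) x = 0.
Proof.
set e := mcoeff _.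
have e_gen i : e (free_gen i) = 0.
  rewrite /e mcoeffU; case: eqP => // /(congr1 (@fmonom_val _)).
  by rewrite fmU fm1.
have eM u v : e (u * v) = e u * e v by apply: rmorphM.
have e_genr u i : e (u * free_gen i) = 0 by rewrite eM e_gen mulr0.
have eB u v : e u = 0 -> e v = 0 -> e (u - v) = 0.
  by move=> u0 v0; rewrite -[RHS](subr0 0) -[X in _ = X - _]u0 -v0; apply: raddfB.
elim=> {x} [|_ [i|i j _|i j _]|x y _ x0 _ y0|a x _ x0|a x _ x0].
- exact: raddf0.
- by apply: eB; [apply: e_genr | apply: e_gen].
- by apply: eB; apply: e_genr.
- by apply: eB; apply: e_genr.
- by rewrite -[RHS](addr0 0) -[X in _ = X + _]x0 -y0; apply: raddfD.
- by rewrite (eM a x) x0 mulr0.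
- by rewrite (eM x a) x0 mul0r.
Qed.

Fact hecke_mulA : associative hecke_mul.
Proof.
elim/quotW=> x; elim/quotW=> y; elim/quotW=> z.
rewrite (hecke_pi_mul y z) (hecke_pi_mul x (y * z)) (hecke_pi_mul x y).
by rewrite (hecke_pi_mul (x * y) z) mulrA.
Qed.
Fact hecke_mul1 : left_id hecke_one hecke_mul.
Proof. by elim/quotW=> x; rewrite (hecke_pi_mul 1 x) mul1r. Qed.
Fact hecke_mulr1 : right_id hecke_one hecke_mul.
Proof. by elim/quotW=> x; rewrite (hecke_pi_mul x 1) mulr1. Qed.
Fact hecke_mulDl : left_distributive hecke_mul +%R.
Proof.
elim/quotW=> x; elim/quotW=> y; elim/quotW=> z; rewrite -quotmod_piD.
rewrite (hecke_pi_mul (x + y) z) (hecke_pi_mul x z) (hecke_pi_mul y z).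
by rewrite mulrDl quotmod_piD.
Qed.
Fact hecke_mulDr : right_distributive hecke_mul +%R.
Proof.
elim/quotW=> x; elim/quotW=> y; elim/quotW=> z; rewrite -quotmod_piD.
rewrite (hecke_pi_mul x (y + z)) (hecke_pi_mul x y) (hecke_pi_mul x z).
by rewrite mulrDr quotmod_piD.
Qed.
Fact hecke_one_neq0 : hecke_one != 0.
Proof.
have -> : 0 = \pi_hecke 0.
  by apply: (addrI (\pi_hecke 0)); rewrite addr0 -quotmod_piD addr0.
apply/(@quotmodP _ _ hecke_ideal) => /hecke_ideal_mcoeff1; rewrite subr0 rmorph1.
by move/eqP; rewrite oner_eq0.
Qed.
HB.instance Definition _ := GRing.Zmodule_isNzRing.Build hecke
  hecke_mulA hecke_mul1 hecke_mulr1 hecke_mulDl hecke_mulDr hecke_one_neq0.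

Lemma hecke_pi_scale (c : k) x : c *: \pi_hecke x = \pi_hecke (c *: x).
Proof. exact: quotmod_pi_scale. Qed.
Lemma hecke_piM x y : \pi_hecke x * \pi_hecke y = \pi_hecke (x * y).
Proof. exact: hecke_pi_mul. Qed.

Fact hecke_scaleAl (c : k) (x y : hecke) : c *: (x * y) = (c *: x) * y.
Proof.
elim/quotW: x => x; elim/quotW: y => y.
rewrite (hecke_piM x y) (hecke_pi_scale c (x * y)) (hecke_pi_scale c x).
by rewrite (hecke_piM (c *: x) y) scalerAl.
Qed.
HB.instance Definition _ := GRing.Lmodule_isLalgebra.Build k hecke hecke_scaleAl.

Lemma free_hecke_scaleAr (c : k) (x y : free_hecke) : c *: (x * y) = x * (c *: y).
Proof.
have central : c%:MP * x = x * c%:MP.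
  rewrite (malgM_def x) fgmulgU mul_malgC; apply: eq_bigr => w _.
  by rewrite mulm1 mulrC.
rewrite -(mul_malgC c (x * y)) -(mul_malgC c y) (mulrA _ x y) (mulrA x _ y).
exact: (congr1 ( *%R^~ y) central).
Qed.

Fact hecke_scaleAr (c : k) (x y : hecke) : c *: (x * y) = x * (c *: y).
Proof.
elim/quotW: x => x; elim/quotW: y => y.
rewrite (hecke_piM x y) (hecke_pi_scale c (x * y)) (hecke_pi_scale c y).
by rewrite (hecke_piM x (c *: y)) free_hecke_scaleAr.
Qed.
HB.instance Definition _ := GRing.Lalgebra_isAlgebra.Build k hecke hecke_scaleAr.

Definition hecke_pi (i : 'I_n.-1) : hecke := \pi_hecke (free_gen i).
Definition hecke_pibar (i : 'I_n.-1) : hecke := hecke_pi i - 1.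

End ZeroHecke.

Section HeckeAction.
Variables (k : fieldType) (n : nat) (V : lmodType k) (op : 'I_n.-1 -> V -> V).
Hypothesis op_linear : forall i, linear (op i).
Hypothesis op_idem : forall i v, op i (op i v) = op i v.
Hypothesis op_braid : forall (i j : 'I_n.-1) v, j = i.+1 :> nat ->
  op i (op j (op i v)) = op j (op i (op j v)).
Hypothesis op_comm : forall (i j : 'I_n.-1) v, (i.+1 < j)%N || (j.+1 < i)%N ->
  op i (op j v) = op j (op i v).

Local Notation free_hecke := {malg k[{fmonom 'I_n.-1}]}.
Implicit Types (x y : free_hecke) (h : hecke k n).

Definition word_act (w : seq 'I_n.-1) (v : V) := foldr op v w.
Definition free_act x v := \sum_(w <- msupp x) mcoeff w x *: word_act w v.
Definition hecke_act h v := free_act (repr h) v.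

Lemma word_act_linear w : linear (word_act w).
Proof.
elim: w => [|i w IHw] a u v //.
by rewrite [LHS](congr1 (op i) (IHw a u v)) op_linear.
Qed.
Lemma word_act0 w : word_act w 0 = 0.
Proof.
by have := word_act_linear w (-1) 0 0; rewrite scaler0 addr0 scaleN1r addNr.
Qed.

Lemma free_actEw (d : {fset {fmonom 'I_n.-1}}) x v : (msupp x `<=` d)%fset ->
  free_act x v = \sum_(w <- d) mcoeff w x *: word_act w v.
Proof.
move=> le_d; apply: big_fset_incl => // w _ /mcoeff_outdom ->.
by rewrite scale0r.
Qed.

Lemma free_actU c w v : free_act << c *g w >> v = c *: word_act w v.
Proof. by rewrite (free_actEw _ msuppU_le) big_seq_fset1 mcoeffUU. Qed.

Lemma free_actD x y v : free_act (x + y) v = free_act x v + free_act y v.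
Proof.
rewrite (free_actEw _ (msuppD_le x y)).
rewrite (free_actEw _ (fsubsetUl (msupp x) (msupp y))).
rewrite (free_actEw _ (fsubsetUr (msupp x) (msupp y))) -big_split /=.
by apply: eq_bigr => w _; rewrite mcoeffD scalerDl.
Qed.

Lemma free_act0 v : free_act 0 v = 0.
Proof. by rewrite /free_act msupp0 big_seq_fset0. Qed.

Lemma free_act_sum (I : Type) (r : seq I) (F : I -> free_hecke) v :
  free_act (\sum_(i <- r) F i) v = \sum_(i <- r) free_act (F i) v.
Proof. exact: (big_morph (free_act^~ v) (fun x y => free_actD x y v) (free_act0 v)). Qed.

Lemma free_act_linear x : linear (free_act x).
Proof.
move=> a u v; rewrite /free_act scaler_sumr -big_split /=.
by apply: eq_bigr => w _; rewrite word_act_linear scalerDr !scalerA mulrC.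
Qed.

Lemma free_act1 v : free_act 1 v = v.
Proof. by rewrite free_actU scale1r /word_act fm1. Qed.

Lemma word_act_sum w (I : Type) (r : seq I) (c : I -> k) (F : I -> V) :
  word_act w (\sum_(i <- r) c i *: F i) = \sum_(i <- r) c i *: word_act w (F i).
Proof.
elim: r => [|i r IHr]; first by rewrite !big_nil word_act0.
by rewrite !big_cons word_act_linear IHr.
Qed.

Lemma free_actM x y v : free_act (x * y) v = free_act x (free_act y v).
Proof.
rewrite malgME free_act_sum [RHS]/free_act; apply: eq_bigr => w _.
rewrite free_act_sum /free_act word_act_sum scaler_sumr.
apply: eq_bigr => w' _; rewrite -/(free_act _ _) free_actU -scalerA.
by rewrite /word_act fmM foldr_cat.
Qed.

Lemma free_act_gen i v : free_act (free_gen k i) v = op i v.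
Proof. by rewrite free_actU scale1r /word_act fmU. Qed.

Lemma free_actB0 x y v :
  free_act x v = free_act y v -> free_act (x - y) v = 0.
Proof.
move=> exy; apply: (addIr (free_act y v)).
by rewrite -free_actD subrK add0r.
Qed.

Lemma free_act_ideal x v : hecke_ideal_spec x -> free_act x v = 0.
Proof.
have act0 u : free_act u 0 = 0.
  by have := free_act_linear u (-1) 0 0; rewrite scaler0 addr0 scaleN1r addNr.
have gen2 i j u : free_act (free_gen k i * free_gen k j) u = op i (op j u).
  by rewrite (free_actM (free_gen k i)) (free_act_gen i) (free_act_gen j).
have gen3 i j l u : free_act (free_gen k i * free_gen k j * free_gen k l) u
    = op i (op j (op l u)).
  rewrite (free_actM (free_gen k i * free_gen k j)) (gen2 i j).
  by rewrite (free_act_gen l).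
move=> Ix; elim: Ix v => {x} [|_ [i|i j ij|i j ij]|x y _ x0 _ y0|a x _ x0|a x _ x0] v.
- exact: free_act0.
- by apply: free_actB0; rewrite (gen2 i i) (free_act_gen i) op_idem.
- apply: free_actB0.
  exact: (etrans (gen3 i j i v) (etrans (op_braid v ij) (esym (gen3 j i j v)))).
- apply: free_actB0.
  exact: (etrans (gen2 i j v) (etrans (op_comm v ij) (esym (gen2 j i v)))).
- by rewrite free_actD x0 y0 addr0.
- by rewrite free_actM x0 act0.
- by rewrite free_actM x0.
Qed.

Lemma hecke_act_pi x v : hecke_act (\pi_(hecke k n) x) v = free_act x v.
Proof.
rewrite /hecke_act; set y := repr _.
suff e : free_act (y - x) v = 0 by rewrite -[y](subrK x) free_actD e add0r.
apply: free_act_ideal; apply/(@quotmodP _ _ (hecke_ideal k n))/eqP.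
by rewrite reprK.
Qed.

Lemma hecke_act_scaleA g h v :
  hecke_act g (hecke_act h v) = hecke_act (g * h) v.
Proof.
elim/quotW: g => x; elim/quotW: h => y.
rewrite (hecke_piM x y) (hecke_act_pi y v) (hecke_act_pi x).
by rewrite (hecke_act_pi (x * y) v) free_actM.
Qed.
Lemma hecke_act_scale1 : left_id 1 hecke_act.
Proof. by move=> v; rewrite hecke_act_pi free_act1. Qed.
Lemma hecke_act_scaleDr : right_distributive hecke_act +%R.
Proof.
move=> h u v; have := free_act_linear (repr h) 1 u v.
by rewrite !scale1r.
Qed.
Lemma hecke_act_scaleDl v : {morph hecke_act^~ v : g h / g + h}.
Proof.
move=> g h /=; elim/quotW: g => x; elim/quotW: h => y.
rewrite -quotmod_piD (hecke_act_pi x v) (hecke_act_pi y v).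
by rewrite (hecke_act_pi (x + y) v) free_actD.
Qed.

Lemma hecke_act_gen i v : hecke_act (hecke_pi k i) v = op i v.
Proof. by rewrite hecke_act_pi free_act_gen. Qed.

Lemma hecke_act_const c v : hecke_act c%:A v = c *: v.
Proof.
rewrite (hecke_pi_scale c 1) (hecke_act_pi (c *: 1) v).
by rewrite -mul_malgC mulr1 free_actU /word_act fm1.
Qed.

End HeckeAction.

(* A cell is a pair (row, column), rows being numbered from bottom to top.
   A diagram is the list of its cells, and a filling of a diagram D with n
   cells by 1, ..., n is a permutation T of 'I_n: the p-th cell of D contains
   the entry T p, the value i : 'I_n standing for the entry i + 1. *)
Definition cell := (nat * nat)%type.
Definition diagram := seq cell.

Definition cell_at (D : diagram) (p : nat) : cell := nth (0, 0)%N D p.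
Definition left_of (c d : cell) := d == (c.1, c.2.+1).
Definition above (c d : cell) := c == (d.1.+1, d.2).

Section Tableaux.
Variables (n : nat) (D : diagram).
Implicit Types (T : {perm 'I_n}) (i : 'I_n.-1).

Definition standard T :=
  [forall p : 'I_n, forall q : 'I_n,
     (left_of (cell_at D p) (cell_at D q) || above (cell_at D p) (cell_at D q))
       ==> (T p < T q)%N].

Definition syt := {T : {perm 'I_n} | standard T}.
HB.instance Definition _ := SubType.on syt.
HB.instance Definition _ := Finite.on syt.

Definition row_of T (e : 'I_n) : nat := (cell_at D (T^-1%g e)).1.

Fact gen_lt i : (i.+1 < n)%N.
Proof. by rewrite -ltn_predRL. Qed.

Definition entry i : 'I_n := Ordinal (ltnW (gen_lt i)).
Definition entryS i : 'I_n := Ordinal (gen_lt i).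

Definition swap_entries i T : {perm 'I_n} := (T * tperm (entry i) (entryS i))%g.

End Tableaux.

Lemma braid_of_rows (X : Type) (V : zmodType) (st : X -> Prop) (v : X -> V)
    (s t : X -> X) (a b c : X -> nat) (p q : V -> V) :
  p 0 = 0 -> q 0 = 0 -> {morph p : x / - x} -> {morph q : x / - x} ->
  (forall U, a (s U) = b U) -> (forall U, b (s U) = a U) ->
  (forall U, c (s U) = c U) -> (forall U, a (t U) = a U) ->
  (forall U, b (t U) = c U) -> (forall U, c (t U) = b U) ->
  (forall U, st U -> (a U < b U)%N -> p (v U) = v (s U)) ->
  (forall U, st U -> (b U < a U)%N -> p (v U) = - v U) ->
  (forall U, st U -> a U = b U -> p (v U) = 0) ->
  (forall U, st U -> (b U < c U)%N -> q (v U) = v (t U)) ->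
  (forall U, st U -> (c U < b U)%N -> q (v U) = - v U) ->
  (forall U, st U -> b U = c U -> q (v U) = 0) ->
  (forall U, st U -> (a U < b U)%N -> st (s U)) ->
  (forall U, st U -> (b U < c U)%N -> st (t U)) ->
  forall T, st T -> s (t (s T)) = t (s (t T)) ->
  p (q (p (v T))) = q (p (q (v T))).
Proof.
move=> p0 q0 pN qN as_ bs cs at_ bt ct plt pgt peq qlt qgt qeq sts stt T stT e3.
have [lab|lab|eab] := ltngtP (a T) (b T);
have [lbc|lbc|ebc] := ltngtP (b T) (c T);
have [lac|lac|eac] := ltngtP (a T) (c T);
try (exfalso; lia).
all: have S1 := sts T stT; have S2 := stt T stT;
     have S3 := sts (t T); have S4 := stt (s T);
     rewrite ?(as_, bs, cs, at_, bt, ct) in S3 S4.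
all: try specialize (S1 ltac:(lia)); try specialize (S2 ltac:(lia));
     try specialize (S3 S2 ltac:(lia)); try specialize (S4 S1 ltac:(lia)).
all: repeat first
 [ progress rewrite ?p0 ?q0 ?pN ?qN
 | rewrite plt; [ | assumption | rewrite ?(as_, bs, cs, at_, bt, ct); lia]
 | rewrite pgt; [ | assumption | rewrite ?(as_, bs, cs, at_, bt, ct); lia]
 | rewrite peq; [ | assumption | rewrite ?(as_, bs, cs, at_, bt, ct); lia]
 | rewrite qlt; [ | assumption | rewrite ?(as_, bs, cs, at_, bt, ct); lia]
 | rewrite qgt; [ | assumption | rewrite ?(as_, bs, cs, at_, bt, ct); lia]
 | rewrite qeq; [ | assumption | rewrite ?(as_, bs, cs, at_, bt, ct); lia] ].
all: rewrite ?oppr0 ?opprK ?e3 //.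
Qed.

Section TableauModule.
Variables (k : fieldType) (n : nat) (D : diagram).
Implicit Types (T U : {perm 'I_n}) (i j : 'I_n.-1).
Local Notation space := {ffun syt n D -> k^o}.

(* the basis vector T if T is standard, and 0 otherwise *)
Definition tab_vec T : space := [ffun U => (T == val U)%:R].

Definition pibar_tab i T : space :=
  if (row_of D T (entryS i) < row_of D T (entry i))%N then - tab_vec T
  else if row_of D T (entry i) == row_of D T (entryS i) then 0
  else tab_vec (swap_entries i T).

Definition pibar_op i (f : space) : space :=
  \sum_T f T *: pibar_tab i (val T).

Definition pi_op i (f : space) : space := pibar_op i f + f.

Lemma tab_vec_eq0 T : ~~ standard D T -> tab_vec T = 0.
Proof.
move=> nstT; apply/ffunP => U; rewrite !ffunE; case: eqP => // eTU.
by rewrite eTU (valP U) in nstT.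
Qed.

Lemma tab_vec_span (f : space) : f = \sum_T f T *: tab_vec (val T).
Proof.
apply/ffunP => U; rewrite sum_ffunE (bigD1 U) //= big1 ?addr0.
  by rewrite !ffunE eqxx [_ *: _]mulr1.
by move=> T neTU; rewrite !ffunE (inj_eq val_inj) (negPf neTU) scaler0.
Qed.

Lemma pibar_op_linear i : linear (pibar_op i).
Proof.
move=> a f g; rewrite /pibar_op scaler_sumr -big_split /=.
by apply: eq_bigr => T _; rewrite !ffunE scalerDl scalerA.
Qed.

Lemma pibar_op_vec i T : standard D T -> pibar_op i (tab_vec T) = pibar_tab i T.
Proof.
move=> stT; rewrite /pibar_op (bigD1 (Sub T stT : syt n D)) //= big1.
  by rewrite ffunE /= eqxx scale1r addr0.
move=> U /eqP neUT; rewrite ffunE; case: eqP => [eTU|_]; last by rewrite scale0r.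
by case: neUT; apply: val_inj; rewrite /= eTU.
Qed.

Lemma val_tperm_entry i (a : 'I_n) :
  tperm (entry i) (entryS i) a
  = (if a == i :> nat then i.+1 else if a == i.+1 :> nat then i : nat else a) :> nat.
Proof.
case: tpermP => [->|->|/eqP n1 /eqP n2] /=; first by rewrite eqxx.
  by rewrite eqxx gtn_eqF.
by move: n1 n2; rewrite -!val_eqE /= => /negPf -> /negPf ->.
Qed.

Lemma standard_swap i T : standard D T ->
  (row_of D T (entry i) < row_of D T (entryS i))%N ->
  standard D (swap_entries i T).
Proof.
move=> /forallP stT ltr; apply/forallP => p; apply/forallP => q.
apply/implyP => adj; have /forallP/(_ q)/implyP/(_ adj) := stT p.
have : ~ (T p = i :> nat /\ T q = i.+1 :> nat).
  case=> ep eq.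
  have Tp : T p = entry i by apply: val_inj.
  have Tq : T q = entryS i by apply: val_inj.
  move: ltr; rewrite /row_of -Tp -Tq !permK.
  case/orP: adj => /eqP -> /=; first by rewrite ltnn.
  by rewrite ltnNge leqnSn.
rewrite !permM !val_tperm_entry.
case: (T p =P i :> nat) => ?; case: (T p =P i.+1 :> nat) => ?;
by case: (T q =P i :> nat) => ?; case: (T q =P i.+1 :> nat) => ?; lia.
Qed.

Lemma row_of_swap i T e :
  row_of D (swap_entries i T) e = row_of D T (tperm (entry i) (entryS i) e).
Proof. by rewrite /row_of invMg permM tpermV. Qed.

Lemma pibar_op_lt i T : standard D T ->
  (row_of D T (entry i) < row_of D T (entryS i))%N ->
  pibar_op i (tab_vec T) = tab_vec (swap_entries i T).
Proof. by move=> st lt; rewrite pibar_op_vec // /pibar_tab ltnNge ltnW //= ltn_eqF. Qed.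

Lemma pibar_op_gt i T : standard D T ->
  (row_of D T (entryS i) < row_of D T (entry i))%N ->
  pibar_op i (tab_vec T) = - tab_vec T.
Proof. by move=> st gt; rewrite pibar_op_vec // /pibar_tab gt. Qed.

Lemma pibar_op_eq i T : standard D T ->
  row_of D T (entry i) = row_of D T (entryS i) ->
  pibar_op i (tab_vec T) = 0.
Proof. by move=> st e; rewrite pibar_op_vec // /pibar_tab e ltnn eqxx. Qed.

HB.instance Definition _ i :=
  GRing.isLinear.Build k space space *:%R (pibar_op i) (pibar_op_linear i).

Lemma linear_ext (f g : space -> space) : linear f -> linear g ->
  (forall T, standard D T -> f (tab_vec T) = g (tab_vec T)) -> f =1 g.
Proof.
move=> lf lg fg x.
pose f' := HB.pack_for {linear space -> space} f (GRing.isLinear.Build _ _ _ _ f lf).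
pose g' := HB.pack_for {linear space -> space} g (GRing.isLinear.Build _ _ _ _ g lg).
rewrite [x]tab_vec_span -[f]/(f' : _ -> _) -[g]/(g' : _ -> _) !linear_sum.
by apply: eq_bigr => T _; rewrite !linearZ /= fg // (valP T).
Qed.

Lemma pibar_op_idem i f : pibar_op i (pibar_op i f) = - pibar_op i f.
Proof.
move: f; apply: linear_ext => [a u v|a u v|T stT].
- by rewrite !linearP.
- by rewrite linearP opprD scalerN.
have [lt|gt|e] := ltngtP (row_of D T (entry i)) (row_of D T (entryS i)).
- rewrite (pibar_op_lt stT) // (pibar_op_gt (standard_swap stT lt)) //.
  by rewrite !row_of_swap tpermL tpermR.
- by rewrite (pibar_op_gt stT) // linearN /= (pibar_op_gt stT).
- by rewrite (pibar_op_eq stT) // linear0 oppr0.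
Qed.

Lemma pibar_op_comm i j f : (i.+1 < j)%N || (j.+1 < i)%N ->
  pibar_op i (pibar_op j f) = pibar_op j (pibar_op i f).
Proof.
move=> far; move: f; apply: linear_ext => [a u v|a u v|T stT].
- by rewrite !linearP.
- by rewrite !linearP.
have [d1 d2 d3 d4] : [/\ entry i != entry j, entry i != entryS j,
   entryS i != entry j & entryS i != entryS j].
  by split; rewrite -val_eqE /=; lia.
have rij U : (row_of D (swap_entries j U) (entry i) = row_of D U (entry i))
           * (row_of D (swap_entries j U) (entryS i) = row_of D U (entryS i)).
  by rewrite !row_of_swap !tpermD // eq_sym.
have rji U : (row_of D (swap_entries i U) (entry j) = row_of D U (entry j))
           * (row_of D (swap_entries i U) (entryS j) = row_of D U (entryS j)).
  by rewrite !row_of_swap !tpermD.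
have swapC : swap_entries i (swap_entries j T) = swap_entries j (swap_entries i T).
  rewrite /swap_entries -!mulgA; congr (_ * _)%g.
  by rewrite [RHS]conjgC tpermJ !tpermD // eq_sym.
have [lti|gti|ei] := ltngtP (row_of D T (entry i)) (row_of D T (entryS i));
  have [ltj|gtj|ej] := ltngtP (row_of D T (entry j)) (row_of D T (entryS j));
  rewrite ?(pibar_op_lt stT lti) ?(pibar_op_gt stT gti) ?(pibar_op_eq stT ei)
    ?(pibar_op_lt stT ltj) ?(pibar_op_gt stT gtj) ?(pibar_op_eq stT ej)
    ?linearN ?linear0 /= ?(pibar_op_gt stT gti) ?(pibar_op_gt stT gtj)
    ?(pibar_op_lt stT lti) ?(pibar_op_lt stT ltj)
    ?(pibar_op_eq stT ei) ?(pibar_op_eq stT ej) ?oppr0 //.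
- rewrite (pibar_op_lt (standard_swap stT ltj)) ?rij //.
  by rewrite (pibar_op_lt (standard_swap stT lti)) ?rji // swapC.
- by rewrite (pibar_op_gt (standard_swap stT lti)) ?rji.
- by rewrite (pibar_op_eq (standard_swap stT lti)) ?rji.
- by rewrite (pibar_op_gt (standard_swap stT ltj)) ?rij.
- by rewrite (pibar_op_eq (standard_swap stT ltj)) ?rij.
Qed.

Lemma pibar_op_braid i j f : j = i.+1 :> nat ->
  pibar_op i (pibar_op j (pibar_op i f)) = pibar_op j (pibar_op i (pibar_op j f)).
Proof.
move=> ij; move: f; apply: linear_ext => [a u v|a u v|T stT].
- by rewrite !linearP.
- by rewrite !linearP.
have eS : entryS i = entry j by apply: val_inj.
have [d1 d2 d3] : [/\ entry i != entry j, entry j != entryS j & entry i != entryS j].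
  by split; rewrite -val_eqE /=; lia.
have Ri U : (row_of D (swap_entries i U) (entry i) = row_of D U (entry j))
          * (row_of D (swap_entries i U) (entry j) = row_of D U (entry i))
          * (row_of D (swap_entries i U) (entryS j) = row_of D U (entryS j)).
  by rewrite !row_of_swap eS tpermL tpermR tpermD // eq_sym.
have Rj U : (row_of D (swap_entries j U) (entry i) = row_of D U (entry i))
          * (row_of D (swap_entries j U) (entry j) = row_of D U (entryS j))
          * (row_of D (swap_entries j U) (entryS j) = row_of D U (entry j)).
  by rewrite !row_of_swap tpermL tpermR tpermD // eq_sym.
have swap3 : swap_entries i (swap_entries j (swap_entries i T))
           = swap_entries j (swap_entries i (swap_entries j T)).
  rewrite /swap_entries eS -!mulgA; congr (_ * _)%g.
  rewrite -[X in (X * _)%g = _]tpermV -[X in _ = (X * _)%g]tpermV -!conjgE !tpermJ.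
  by rewrite tpermL tpermR !tpermD // eq_sym.
apply: (braid_of_rows (st := fun U => standard D U)
  (a := fun U => row_of D U (entry i)) (b := fun U => row_of D U (entry j))
  (c := fun U => row_of D U (entryS j)) _ _ _ _ _ _ _ _ _ _ _ _ _ _ _ _ _ _ stT swap3).
- exact: linear0.
- exact: linear0.
- exact: linearN.
- exact: linearN.
- by move=> U; rewrite Ri.
- by move=> U; rewrite Ri.
- by move=> U; rewrite Ri.
- by move=> U; rewrite Rj.
- by move=> U; rewrite Rj.
- by move=> U; rewrite Rj.
- by move=> U stU lt; apply: pibar_op_lt; rewrite ?eS.
- by move=> U stU gt; apply: pibar_op_gt; rewrite ?eS.
- by move=> U stU e; apply: pibar_op_eq; rewrite ?eS.
- by move=> U stU lt; apply: pibar_op_lt.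
- by move=> U stU gt; apply: pibar_op_gt.
- by move=> U stU e; apply: pibar_op_eq.
- by move=> U stU lt; apply: standard_swap; rewrite ?eS.
- by move=> U stU lt; apply: standard_swap.
Qed.

Fact pi_op_linear i : linear (pi_op i).
Proof. by move=> a f g; rewrite /pi_op linearP scalerDr addrACA. Qed.
Fact pi_op_idem i f : pi_op i (pi_op i f) = pi_op i f.
Proof. by rewrite /pi_op linearD /= pibar_op_idem addrA addNr add0r. Qed.
Fact pi_op_braid i j f : j = i.+1 :> nat ->
  pi_op i (pi_op j (pi_op i f)) = pi_op j (pi_op i (pi_op j f)).
Proof.
move=> ij; rewrite /pi_op !linearD /= !pibar_op_idem (pibar_op_braid _ ij).
set x := pibar_op j (pibar_op i (pibar_op j f)).
set ijf := pibar_op i (pibar_op j f); set jif := pibar_op j (pibar_op i f).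
set fi := pibar_op i f; set fj := pibar_op j f.
rewrite (addNr fi) (addNr fj) !addr0 -!addrA; congr (x + _).
by rewrite addrCA; congr (_ + (_ + _)); rewrite addrCA.
Qed.
Fact pi_op_comm i j f : (i.+1 < j)%N || (j.+1 < i)%N ->
  pi_op i (pi_op j f) = pi_op j (pi_op i f).
Proof.
move=> ij; rewrite /pi_op !linearD /= (pibar_op_comm _ ij).
by rewrite -!addrA; congr (_ + _); rewrite addrCA.
Qed.

(* The module P_D: the space with basis the standard tableaux of shape D, as a
   module over the 0-Hecke algebra. *)
Definition tabmod := space.
HB.instance Definition _ := GRing.Zmodule.on tabmod.
HB.instance Definition _ := GRing.Zmodule_isLmodule.Build (hecke k n) tabmod
  (hecke_act_scaleA pi_op_linear pi_op_idem pi_op_braid pi_op_comm)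
  (hecke_act_scale1 pi_op_linear pi_op_idem pi_op_braid pi_op_comm)
  (hecke_act_scaleDr pi_op_linear)
  (hecke_act_scaleDl pi_op_linear pi_op_idem pi_op_braid pi_op_comm).

Lemma hecke_pi_tabmod i (f : tabmod) : hecke_pi k i *: f = pi_op i f :> tabmod.
Proof. exact: hecke_act_gen pi_op_linear pi_op_idem pi_op_braid pi_op_comm i f. Qed.

Lemma hecke_pibar_tab i T : standard D T ->
  hecke_pibar k i *: (tab_vec T : tabmod) = pibar_tab i T :> tabmod.
Proof.
move=> stT; rewrite /hecke_pibar scalerBl scale1r hecke_pi_tabmod.
by rewrite /pi_op pibar_op_vec // addrK.
Qed.

Lemma hecke_const_tabmod (c : k) (f : tabmod) :
  (c%:A : hecke k n) *: f = (c *: (f : space)) :> tabmod.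
Proof.
exact: hecke_act_const pi_op_linear pi_op_idem pi_op_braid pi_op_comm c f.
Qed.

End TableauModule.

(* The empty composition of 0 is excluded: near-concatenation and the gluing of
   ribbon components only make sense for nonempty compositions. *)
Definition is_composition (a : seq nat) := (a != [::]) && all (ltn 0) a.

(* the ribbon whose southwesternmost cell is (r, c) *)
Fixpoint ribbon_at (r c : nat) (a : seq nat) : diagram :=
  if a is m :: a' then
    [seq (r, j) | j <- iota c m] ++ ribbon_at r.+1 (c + m).-1 a'
  else [::].

Fixpoint gribbon_at (c : cell) (g : seq (seq nat)) : diagram :=
  if g is a :: g' then
    let D := ribbon_at c.1 c.2 a in
    let ne := last c D in
    D ++ gribbon_at (ne.1.+1, ne.2.+1) g'
  else [::].

(* The cells of a generalized ribbon are listed from southwest to northeast. *)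
Definition Diag (g : seq (seq nat)) : diagram := gribbon_at (0, 0)%N g.

Lemma size_Diag g : size (Diag g) = sumn (map sumn g).
Proof.
have szr a r c : size (ribbon_at r c a) = sumn a.
  elim: a r c => //= m a IHa r c.
  by rewrite size_cat size_map size_iota IHa.
rewrite /Diag; elim: g (0, 0)%N => //= a g IHg c.
by rewrite size_cat szr IHg.
Qed.

Definition near_concat (a b : seq nat) : seq nat :=
  take (size a).-1 a ++ (last 0 a + head 0 b)%N :: behead b.

(* near_concat is applied at the commas where the bit is true *)
Fixpoint glue_from (bits : bitseq) (a : seq nat) (g : seq (seq nat)) :=
  match g, bits with
  | b :: g', true :: bits' => glue_from bits' (near_concat a b) g'
  | b :: g', _ => a :: glue_from (behead bits) b g'
  | [::], _ => [:: a]
  end.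

Definition glue_at (bits : bitseq) (g : seq (seq nat)) :=
  if g is a :: g' then glue_from bits a g' else [::].

Lemma sumn_near_concat a b : sumn (near_concat a b) = (sumn a + sumn b)%N.
Proof.
rewrite /near_concat sumn_cat /=.
have -> : sumn b = (head 0 b + sumn (behead b))%N by case: b.
elim/last_ind: a => [|a x _]; first by rewrite /= add0n.
rewrite size_rcons /= -cats1 take_size_cat // last_cat sumn_cat /=.
by rewrite addn0 !addnA.
Qed.

Lemma sumn_glue_at bits g : sumn (map sumn (glue_at bits g)) = sumn (map sumn g).
Proof.
case: g => //= a g; elim: g a bits => [|b g IHg] a [|[] bits] //=.
- by rewrite IHg.
- by rewrite IHg sumn_near_concat addnA.
- by rewrite IHg.
Qed.

Section RibbonComplex.
Variables (k : fieldType) (n : nat) (alpha : seq (seq nat)).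

(* the set [l - 1] of the commas of alpha *)
Local Notation comma := 'I_(size alpha).-1.

Definition glue (I : {set comma}) : seq (seq nat) :=
  glue_at [seq j \in I | j <- enum comma] alpha.

Definition ribbon_shape (I : {set comma}) : diagram := Diag (glue I).

Definition ribbon_cochain (i : nat) : lmodType (hecke k n) :=
  dsum (fun I : {I : {set comma} | #|I| == i} => tabmod k n (ribbon_shape (val I))).

(* Gluing components translates them one unit down, which does not change the
   order of the cells from southwest to northeast: the glued filling with the
   same entries is the same permutation. *)
Definition glue_map (I J : {set comma}) (f : tabmod k n (ribbon_shape I)) :
    tabmod k n (ribbon_shape J) :=
  \sum_T f T *: tab_vec k (ribbon_shape J) (val T).

Definition sgn (j : comma) (I : {set comma}) : hecke k n :=
  (-1) ^+ #|[set t in I | (t < j)%N]|.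

(* the component at J = I :|: [set j] of the image of f in component I is
   sgn j I times the image of f by glue_map *)
Definition ribbon_codiff (i : nat) (x : ribbon_cochain i) : ribbon_cochain i.+1 :=
  dsum_of (fun J : {J : {set comma} | #|J| == i.+1} =>
    \sum_(I : {I : {set comma} | #|I| == i})
      \sum_(j | (j \notin val I) && (j |: val I == val J))
         sgn j (val I) *: glue_map (val J) (x I)).

End RibbonComplex.

(* Main.v *)
Require Import Defs.
From HB Require Import structures.
From mathcomp Require Import all_boot all_order all_algebra all_fingroup.
From mathcomp Require Import zify ring generic_quotient.
From mathcomp Require boolp.

Set Implicit Arguments.
Unset Strict Implicit.
Unset Printing Implicit Defensive.

Import GRing.Theory.
Local Open Scope ring_scope.

(** List the cells from southwest to northeast. All the shapes involved are
    walks with the same steps inside the ribbons; they differ only at the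
    commas, where the step is east if the comma is glued, northeast if it is
    not, and north in the ribbon of the concatenation. A filling T is standard
    iff it is increasing at each east step and decreasing at each north step.
    So, if T satisfies the conditions inside the ribbons and A is the set of the
    commas where it is increasing, then T is standard of shape I iff I is
    contained in A, and standard for the concatenation iff A is empty. For each
    such T the complex is therefore the Koszul complex of the subsets of A, which
    is contractible if A is nonempty and lives in degree 0 otherwise. The maps
    which keep the filling if it is standard and kill it otherwise are
    equivariant as long as steps only change from north to northeast to east. *)

(** * Walks and the maps between their tableau modules *)

(* whether the row, respectively the column, increases by one *)
Definition step := (bool * bool)%type.
Definition east : step := (false, true).
Definition north : step := (true, false).
Definition northeast : step := (true, true).

Definition advance (c : cell) (s : step) : cell := (c.1 + s.1, c.2 + s.2)%N.

Section Steps.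
Variables (n : nat).
Implicit Types (D : diagram) (s : 'I_n.-1 -> step) (T : {perm 'I_n}).

(* Here i : 'I_n.-1 stands for the pair of consecutive cells i, i + 1. *)
Definition follows D s :=
  forall i, (s i).1 || (s i).2 /\ cell_at D i.+1 = advance (cell_at D i) (s i).

(** An east step demands an ascent, a north step a descent, and a northeast step nothing. *)
Definition step_ok T (i : 'I_n.-1) (st : step) :=
  (st.1 || (T (entry i) < T (entryS i))%N)
  && (st.2 || (T (entryS i) < T (entry i))%N).

Lemma ord_pairP (p q : 'I_n) : q = p.+1 :> nat ->
  exists i : 'I_n.-1, p = entry i /\ q = entryS i.
Proof.
move=> e; have lt : (p < n.-1)%N by have := ltn_ord q; rewrite e; lia.
by exists (Ordinal lt); split; apply: val_inj.
Qed.

Section OneDiagram.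
Variables (D : diagram) (s : 'I_n.-1 -> step).
Hypothesis sD : follows D s.

Lemma follows_height (p q : nat) : (p <= q)%N -> (q < n)%N ->
  ((cell_at D p).1 + (cell_at D p).2 + (q - p)
     <= (cell_at D q).1 + (cell_at D q).2)%N.
Proof.
elim: q => [|q IHq]; first by rewrite leqn0 => /eqP -> _; lia.
rewrite leq_eqVlt => /orP[/eqP -> _|lt ltn]; first by lia.
have lt' : (q < n.-1)%N by lia.
have := IHq lt (ltnW ltn); have [] := sD (Ordinal lt'); rewrite /advance /= => + ->.
by case: (s _) => [] [] [] //=; lia.
Qed.

Lemma follows_row (p q : nat) : (p <= q)%N -> (q < n)%N ->
  ((cell_at D p).1 <= (cell_at D q).1)%N.
Proof.
elim: q => [|q IHq]; first by rewrite leqn0 => /eqP ->.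
rewrite leq_eqVlt => /orP[/eqP -> //|lt ltn].
have lt' : (q < n.-1)%N by lia.
have [_ ->] := sD (Ordinal lt'); apply: leq_trans (leq_addr _ _).
exact: IHq (ltnW ltn).
Qed.

(** Rows never decrease along the walk, so they agree at both ends exactly when no step in between
    rises. *)
Lemma follows_row_eq (p q : nat) : (p <= q)%N -> (q < n)%N ->
  ((cell_at D p).1 == (cell_at D q).1) =
    [forall i : 'I_n.-1, (p <= i < q)%N ==> ~~ (s i).1].
Proof.
move=> lepq ltqn; apply/eqP/forallP => [e i|allE].
  apply/implyP => /andP[lepi ltiq]; have [_] := sD i.
  have := follows_row lepi (ltnW (gen_lt i)).
  have := follows_row ltiq ltqn.
  by move=> + + e'; rewrite e' /= -e; case: (s i).1 => //=; lia.
elim: q lepq ltqn allE => [|q IHq]; first by rewrite leqn0 => /eqP ->.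
rewrite leq_eqVlt => /orP[/eqP -> //|lt] ltn allE.
have lt' : (q < n.-1)%N by lia.
have [_ ->] := sD (Ordinal lt'); have /implyP := allE (Ordinal lt').
rewrite /= ltnSn andbT => /(_ lt) /negPf ->; rewrite addn0.
apply: IHq => //; first exact: ltnW.
move=> i; apply/implyP => /andP[lepi ltiq]; have /implyP := allE i; apply.
by rewrite lepi ltnW.
Qed.

(** Row plus column grows by at least one per step, so a difference of exactly one occurs only
    between consecutive cells. *)
Lemma follows_succ (p q : 'I_n) :
  ((cell_at D q).1 + (cell_at D q).2 = ((cell_at D p).1 + (cell_at D p).2).+1)%N ->
  exists i : 'I_n.-1, p = entry i /\ q = entryS i.
Proof.
move=> e; apply: ord_pairP.
have := @follows_height p q; have := @follows_height q p.
by have := ltn_ord p; have := ltn_ord q; lia.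
Qed.

(** Adjacent boxes differ by one in row plus column, hence are consecutive in the list by
    [follows_succ], and the step joining them decides which condition holds. *)
Lemma standardE T : standard D T = [forall i, step_ok T i (s i)].
Proof.
apply/forallP/forallP => [stT i|okT p].
  have [st e] := sD i; apply/andP; split.
    case e1: (s i).1 => //=; move: st; rewrite e1 /= => e2.
    have /forallP/(_ (entryS i))/implyP := stT (entry i); apply.
    by rewrite /left_of [cell_at D (entryS i)]e /advance e1 e2 addn0 addn1 eqxx.
  case e2: (s i).2 => //=; move: st; rewrite e2 orbF => e1.
  have /forallP/(_ (entry i))/implyP := stT (entryS i); apply.
  by rewrite /above [cell_at D (entryS i)]e /advance e1 e2 addn0 addn1 eqxx orbT.
apply/forallP => q; apply/implyP => /orP[/eqP adj|/eqP adj].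
  have [|i [ep eq]] := @follows_succ p q; first by rewrite adj /= addnS.
  have := okT i; rewrite /step_ok -ep -eq.
  have [_] := sD i; rewrite -[i.+1]/(val (entryS i)) -[val i]/(val (entry i)).
  rewrite -ep -eq adj => -[e _].
  by case: (s i).1 e => //= [|_ /andP[]//]; lia.
have [|i [ep eq]] := @follows_succ q p; first by rewrite adj.
have := okT i; rewrite /step_ok -ep -eq.
have [_] := sD i; rewrite -[i.+1]/(val (entryS i)) -[val i]/(val (entry i)).
rewrite -ep -eq adj => -[_ e].
by case: (s i).2 e => //= [|_ /andP[]//]; lia.
Qed.

(** Steps within a row are east, so their ascents chain. This rules out fillings when rows merge. *)
Lemma standard_row_lt T (p q : 'I_n) : standard D T -> (p < q)%N ->
  (cell_at D p).1 = (cell_at D q).1 -> (T p < T q)%N.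
Proof.
rewrite standardE => /forallP okT ltpq /eqP.
rewrite (follows_row_eq (ltnW ltpq)) // => /forallP noN.
have ltqn := ltn_ord q.
have [m lem] := ubnP (q - p)%N; elim: m => // m IHm in p q ltpq noN ltqn lem *.
have ltp : (p < n.-1)%N by lia.
have lt1 : (T (entry (Ordinal ltp)) < T (entryS (Ordinal ltp)))%N.
  have /implyP := noN (Ordinal ltp); rewrite /= leqnn ltpq => /(_ isT) n1.
  by have /andP[] := okT (Ordinal ltp); rewrite (negPf n1).
have -> : p = entry (Ordinal ltp) by apply: val_inj.
apply: leq_trans lt1 _.
have [e|lt2] := eqVneq (p.+1 : nat) q.
  by have -> : q = entryS (Ordinal ltp) by apply: val_inj.
have lt3 : (p.+1 < q)%N by rewrite ltn_neqAle lt2.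
apply/ltnW/IHm => //=; last by lia.
move=> i; apply/implyP => /andP[? ?]; have /implyP := noN i; apply.
by apply/andP; split; lia.
Qed.

End OneDiagram.

Lemma tab_vec_ext (k : fieldType) D (V : lmodType k)
    (F G : {linear {ffun syt n D -> k^o} -> V}) :
  (forall T, standard D T -> F (tab_vec k D T) = G (tab_vec k D T)) -> F =1 G.
Proof.
move=> FG f; rewrite [f]tab_vec_span !linear_sum; apply: eq_bigr => T _.
by rewrite !linearZ /= FG // (valP T).
Qed.

Section Transfer.
Variables (k : fieldType) (D E : diagram).
Local Notation space D := {ffun syt n D -> k^o}.
Implicit Types (f g : space D).

(** The formula of [glue_map] for arbitrary shapes, so that it also serves for the map out of the
    concatenated ribbon. *)
Definition transfer f : space E := \sum_T f T *: tab_vec k E (val T).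

Fact transfer_linear_space : linear transfer.
Proof.
move=> a f g; rewrite /transfer scaler_sumr -big_split /=.
by apply: eq_bigr => T _; rewrite !ffunE scalerDl scalerA.
Qed.

HB.instance Definition _ :=
  GRing.isLinear.Build k (space D) (space E) *:%R transfer transfer_linear_space.

Lemma transfer_vec T : standard D T -> transfer (tab_vec k D T) = tab_vec k E T.
Proof.
move=> stT; rewrite /transfer (bigD1 (Sub T stT : syt n D)) //= big1.
  by rewrite ffunE /= eqxx scale1r addr0.
move=> U /eqP neUT; rewrite ffunE; case: eqP => [eTU|_]; last by rewrite scale0r.
by case: neUT; apply: val_inj; rewrite /= eTU.
Qed.

Variables (s t : 'I_n.-1 -> step).
Hypotheses (sD : follows D s) (tE : follows E t).
Hypotheses (st1 : forall i, (t i).1 ==> (s i).1) (st2 : forall i, (s i).2 ==> (t i).2).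

(** By [st1] the walk of [E] rises only where that of [D] does: rows may merge but never split. *)
Lemma row_eq_transfer (p q : 'I_n) :
  (cell_at D p).1 = (cell_at D q).1 -> (cell_at E p).1 = (cell_at E q).1.
Proof.
wlog lepq : p q / (p <= q)%N.
  move=> W; case: (leqP p q) => [|/ltnW] le; first exact: W.
  by move/esym => e; rewrite (W _ _ le e).
move/eqP; rewrite (follows_row_eq sD lepq) // => /forallP noN.
apply/eqP; rewrite (follows_row_eq tE lepq) //.
apply/forallP => i; apply/implyP => /(implyP (noN i)).
by apply: contra => t1; exact: (implyP (st1 i)).
Qed.

Lemma row_lt_transfer (p q : 'I_n) :
  ((cell_at D p).1 < (cell_at D q).1)%N -> ((cell_at E p).1 <= (cell_at E q).1)%N.
Proof.
move=> lt; case: (leqP p q) => [le|/ltnW le]; first exact: follows_row tE _ _ le _.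
by have := follows_row sD le (ltn_ord p); lia.
Qed.

Lemma row_ltW (p q : 'I_n) :
  ((cell_at D p).1 < (cell_at D q).1)%N -> (p < q)%N.
Proof. by move=> lt; case: leqP => // /(follows_row sD)/(_ (ltn_ord _)); lia. Qed.

(* If swapping i and i + 1 repairs a violated condition of E, then i + 1 and i lie
   in consecutive cells, in this order, so that i + 1 is not in a higher row. *)
Lemma transfer_swap_nstandard i T : standard D T -> ~~ standard E T ->
  (row_of D T (entry i) < row_of D T (entryS i))%N ->
  ~~ standard E (swap_entries i T).
Proof.
rewrite (standardE sD) !(standardE tE) => /forallP stT.
case/forallPn => j nok lt; apply/forallPn; exists j.
have := stT j; move: nok; rewrite /step_ok /swap_entries !permM !val_tperm_entry.
have dif : T (entry j) <> T (entryS j) :> nat.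
  by move=> /val_inj/perm_inj/(congr1 val) /=; lia.
have nbad : ~ (T (entry j) = i.+1 :> nat /\ T (entryS j) = i :> nat).
  case=> ep eq; have Tp : T (entry j) = entryS i by apply: val_inj.
  have Tq : T (entryS j) = entry i by apply: val_inj.
  move: lt; rewrite /row_of -Tp -Tq !permK => /row_ltW /=; lia.
(* The swap alters the comparison at [j] only if the entries there are [i] and [i + 1]. The
   descending order is excluded by [nbad]; in the ascending order the violated step of [E] is north,
   hence north in [D] as well, against [stT]. *)
have [/implyP s1 /implyP s2] := (st1 j, st2 j).
have [/orP or _] := tE j; have [/orP or' _] := sD j.
move: s1 s2 or or'; case: (s j) => [] a b; case: (t j) => [] c d /=.
case: (T (entry j) =P i :> nat) => ?; case: (T (entry j) =P i.+1 :> nat) => ?;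
  case: (T (entryS j) =P i :> nat) => ?; case: (T (entryS j) =P i.+1 :> nat) => ?;
  case: a; case: b; case: c; case: d => //= s1 s2 ? ?;
  try (by have := s1 isT); try (by have := s2 isT); try lia.
Qed.

(** From [D] to [E] the rows of [i] and [i + 1] keep their order or merge. If they keep it, the same
    rule applies on both sides; if they merge, both sides turn out to be 0. *)
Lemma transfer_pibar i T : standard D T ->
  transfer (pibar_op i (tab_vec k D T)) = pibar_op i (tab_vec k E T).
Proof.
move=> stT; set p := T^-1%g (entry i); set q := T^-1%g (entryS i).
have row0 : row_of E T (entry i) = row_of E T (entryS i) ->
    pibar_op i (tab_vec k E T) = 0.
  move=> e; have [stE|nst] := boolP (standard E T); first exact: pibar_op_eq.
  by rewrite tab_vec_eq0 // linear0.
have Tp : T p = entry i by rewrite permKV.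
have Tq : T q = entryS i by rewrite permKV.
have [lt|gt|e] := ltngtP (row_of D T (entry i)) (row_of D T (entryS i)).
- rewrite pibar_op_lt // transfer_vec; last exact: standard_swap.
  have [stE|nst] := boolP (standard E T); last first.
    by rewrite !tab_vec_eq0 ?linear0 // transfer_swap_nstandard.
  have := row_lt_transfer lt; rewrite leq_eqVlt => /orP[/eqP e|ltE]; last first.
    by rewrite pibar_op_lt.
  (* Now [i] and [i + 1] share a row of [E], where the action gives 0; the swapped filling decreases
     along this row, so its image is 0 too. *)
  rewrite row0 // tab_vec_eq0 //; apply/negP => stsw.
  have := standard_row_lt tE stsw (row_ltW lt) e.
  by rewrite /swap_entries !permM -/p -/q Tp Tq tpermL tpermR /=; lia.
- rewrite pibar_op_gt // linearN /= transfer_vec //.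
  have [stE|nst] := boolP (standard E T); last by rewrite !tab_vec_eq0 ?linear0 ?oppr0.
  have := row_lt_transfer gt; rewrite leq_eqVlt => /orP[/eqP e|ltE]; last first.
    by rewrite pibar_op_gt.
  (* Merged rows would make [T] decrease along a row of [E], against [stE]. *)
  by have := standard_row_lt tE stE (row_ltW gt) e; rewrite -/p -/q Tp Tq /=; lia.
- by rewrite pibar_op_eq // linear0 row0 //; apply: row_eq_transfer.
Qed.

Lemma transfer_pi_op i f : transfer (pi_op i f) = pi_op i (transfer f).
Proof.
rewrite /pi_op linearD /=; congr (_ + _); move: f.
apply: (tab_vec_ext (F := transfer \o pibar_op i) (G := pibar_op i \o transfer)).
by move=> T stT; rewrite /= transfer_pibar // transfer_vec.
Qed.

Lemma transfer_linear : linear (transfer : tabmod k n D -> tabmod k n E).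
Proof.
move=> h f g; rewrite [LHS](linearD transfer); congr (_ + _).
have word_transfer w :
    transfer (word_act (@pi_op k n D) w f) = word_act (@pi_op k n E) w (transfer f).
  by elim: w => //= i r IHr; rewrite transfer_pi_op IHr.
(* The algebra acts through a representative in the free algebra, that is, by a combination of words
   in the generators. *)
rewrite /GRing.scale /= /hecke_act /free_act linear_sum; apply: eq_bigr => w _.
by rewrite linearZ /= word_transfer.
Qed.

End Transfer.
End Steps.

(** * Generalized ribbons as walks *)

Definition walk_end (c : cell) (w : seq step) : cell := foldl advance c w.

Definition walk (c : cell) (w : seq step) : diagram := c :: scanl advance c w.

Lemma last_walk c0 c w : last c0 (walk c w) = walk_end c w.
Proof. by rewrite /walk /=; elim: w c => //= s w IHw c; rewrite IHw. Qed.

Lemma walk_cat c w1 s w2 :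
  walk c (w1 ++ s :: w2) = walk c w1 ++ walk (advance (walk_end c w1) s) w2.
Proof. by rewrite /walk scanl_cat. Qed.

Lemma size_walk c w : size (walk c w) = (size w).+1.
Proof. by rewrite /= size_scanl. Qed.

Lemma cell_at_walkS c w s0 i : (i < size w)%N ->
  cell_at (walk c w) i.+1 = advance (cell_at (walk c w) i) (nth s0 w i).
Proof.
rewrite /cell_at /walk; elim: w c i => //= s w IHw c [|i] lt //=.
exact: IHw.
Qed.

Definition east_run (m : nat) : seq step := nseq m.-1 east.

Fixpoint ribbon_steps (a : seq nat) : seq step :=
  if a is m :: a' then
    east_run m ++ (if a' is [::] then [::] else north :: ribbon_steps a')
  else [::].

Lemma walk_east r c m : (0 < m)%N ->
  [seq (r, j) | j <- iota c m] = walk (r, c) (east_run m).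
Proof.
case: m => // m _; rewrite /walk /east_run /=; congr (_ :: _).
by elim: m c => //= m IHm c; rewrite /advance /= addn0 addn1 IHm.
Qed.

Lemma walk_end_east r c m : walk_end (r, c) (east_run m) = (r, c + m.-1)%N.
Proof.
rewrite /east_run; elim: (m.-1) c => /= [|p IHp] c; first by rewrite addn0.
by rewrite /advance /= addn0 IHp; congr pair; lia.
Qed.

Lemma ribbon_atE r c a : is_composition a ->
  ribbon_at r c a = walk (r, c) (ribbon_steps a).
Proof.
case/andP=> + pa; elim: a r c pa => //= m a IHa r c /andP[m0 pa] _.
rewrite walk_east //; case: a => [|m' a] in IHa pa *; first by rewrite !cats0.
rewrite walk_cat IHa // walk_end_east /advance addn1 addn0.
by have -> : (c + m).-1 = (c + m.-1)%N by lia.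
Qed.

Lemma ribbon_steps_cat a b : a != [::] -> b != [::] ->
  ribbon_steps (a ++ b) = ribbon_steps a ++ north :: ribbon_steps b.
Proof.
move=> + nb; elim: a => // m [|m' a] IHa _ /=.
  by case: b nb {IHa} => //= *; rewrite cats0.
by rewrite -catA /= -IHa.
Qed.

Lemma ribbon_steps_near_concat a b : is_composition a -> is_composition b ->
  ribbon_steps (near_concat a b) = ribbon_steps a ++ east :: ribbon_steps b.
Proof.
rewrite /near_concat; case/andP; case/lastP: a => // a m _; rewrite all_rcons.
case/andP=> m0 _; case/andP; case: b => // m' b _ /andP[m'0 _].
rewrite -![ltn 0 _]/(0 < _)%N in m0 m'0.
rewrite size_rcons /= -cats1 take_size_cat // last_cat /=.
(* The merged row has [m + m'] boxes; as both parts are positive, its number of east steps is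
   [(m - 1) + 1 + (m' - 1)]. *)
have run : ribbon_steps (m + m' :: b)%N = east_run m ++ east :: ribbon_steps (m' :: b).
  rewrite /= -cat_cons [RHS]catA; congr (_ ++ _).
  by rewrite /east_run -[east :: _]/(nseq m'.-1.+1 east) -nseqD; congr nseq; lia.
case: a => [|x a]; first by rewrite [LHS]run /= cats0.
by rewrite !ribbon_steps_cat // run -catA /= cats0.
Qed.

Lemma is_composition_near_concat a b : is_composition a -> is_composition b ->
  is_composition (near_concat a b).
Proof.
rewrite /near_concat /is_composition; case/lastP: a => // a m.
rewrite all_rcons size_rcons /= -cats1 take_size_cat // last_cat /=.
case/andP=> _ /andP[m0 pa]; case: b => // m' b /= /andP[m'0 pb].
rewrite all_cat /= pa pb andbT /= addn_gt0 m0; by case: a {pa}.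
Qed.

(* A label is either a step inside a ribbon or the number of a comma. *)
Notation label := (step + nat)%type.

Definition fill (phi : nat -> step) (l : label) : step :=
  match l with inl s => s | inr j => phi j end.

Fixpoint comma_labels (m : nat) (g : seq (seq nat)) : seq label :=
  if g is b :: g' then
    inr m :: map inl (ribbon_steps b) ++ comma_labels m.+1 g'
  else [::].

Definition labels (g : seq (seq nat)) : seq label :=
  if g is a :: g' then map inl (ribbon_steps a) ++ comma_labels 0 g' else [::].

Lemma map_fill_inl phi w : map (fill phi) (map inl w) = w.
Proof. by rewrite -map_comp map_id. Qed.

(** Here [a] is the component glued so far and [m] the number of the next comma; [phi] uses absolute
    comma numbers, while [bits] is consumed from its head. Gluing extends [a] by an east step;
    otherwise [a] is complete and a northeast step starts the next component. *)
Lemma gribbon_at_glue phi m bits c a g :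
  is_composition a -> all is_composition g ->
  (forall i, phi (m + i)%N = if nth false bits i then east else northeast) ->
  gribbon_at c (glue_from bits a g) =
    walk c (ribbon_steps a ++ map (fill phi) (comma_labels m g)).
Proof.
elim: g m bits c a => [|b g IHg] m bits c a ca.
  by case: c => r c _ _; rewrite /= !cats0 ribbon_atE.
case/andP=> cb cg phiE; have phim := phiE 0%N; rewrite addn0 in phim.
have phiS i : phi (m.+1 + i)%N = if nth false (behead bits) i then east else northeast.
  by rewrite addSnnS phiE nth_behead.
rewrite /= map_cat map_fill_inl phim.
(* The unglued case, shared by an empty [bits] and a leading false bit. *)
have step0 : gribbon_at c (a :: glue_from (behead bits) b g) =
    walk c (ribbon_steps a ++ northeast :: ribbon_steps b
      ++ [seq fill phi i | i <- comma_labels m.+1 g]).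
  case: c => r c; rewrite /= ribbon_atE // last_walk walk_cat.
  by rewrite (IHg m.+1) // /advance !addn1.
case: bits {phiE phim} phiS step0 => [|[] bits] //= phiS _.
rewrite (IHg m.+1) ?is_composition_near_concat //.
by rewrite ribbon_steps_near_concat // -catA.
Qed.

Lemma Diag_glue_at bits g : all is_composition g -> g != [::] ->
  Diag (glue_at bits g) =
    walk (0, 0)%N (map (fill (fun j => if nth false bits j then east else northeast))
                       (labels g)).
Proof.
case: g => // a g /andP[ca cg] _; rewrite /Diag /labels map_cat map_fill_inl.
exact: gribbon_at_glue.
Qed.

Lemma is_composition_flatten g : all is_composition g -> g != [::] ->
  is_composition (flatten g).
Proof.
case: g => // a g /andP[/andP[na pa] cg] _; rewrite /is_composition all_cat pa /=.
apply/andP; split; first by case: a na {pa}.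
by elim: g cg => //= b g IHg /andP[/andP[_ pb] /IHg]; rewrite all_cat pb.
Qed.

Lemma ribbon_steps_flatten g : all is_composition g ->
  ribbon_steps (flatten g) = map (fill (fun=> north)) (labels g).
Proof.
case: g => // a g /andP[/andP[na _] cg]; rewrite /= map_cat map_fill_inl.
move: 0%N => m; elim: g a m na cg => [|b g IHg] a m na /=; first by rewrite !cats0.
case/andP=> /andP[nb _] cg; rewrite map_cat map_fill_inl.
rewrite ribbon_steps_cat //; last by case: b nb.
by rewrite (IHg _ m.+1).
Qed.

Lemma Diag_flatten g : all is_composition g -> g != [::] ->
  Diag [:: flatten g] = walk (0, 0)%N (map (fill (fun=> north)) (labels g)).
Proof.
move=> cg ng; rewrite /Diag /= cats0 ribbon_atE ?is_composition_flatten //.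
by rewrite ribbon_steps_flatten.
Qed.

(** A walk has one cell more than steps, and gluing preserves the number of cells. *)
Lemma size_labels g : all is_composition g ->
  size (labels g) = (sumn (map sumn g)).-1.
Proof.
case: g => // a g cg; rewrite -[RHS]/(_.-1) -(sumn_glue_at [::]) -size_Diag.
by rewrite Diag_glue_at // size_walk size_map.
Qed.

(** Each comma labels exactly one step; existence and uniqueness of its position both come from this
    count. *)
Lemma count_inr_labels g j :
  count_mem (inr j) (labels g) = (j < (size g).-1)%N.
Proof.
have inl0 (w : seq step) : count_mem (inr j : label) (map inl w) = 0%N.
  by elim: w => //= s w ->.
case: g => //= a g; rewrite count_cat inl0 add0n.
suff -> m : count_mem (inr j) (comma_labels m g) = (m <= j < m + size g)%N by [].
elim: g m => [|b g IHg] m /=; first by rewrite addn0; case: ltngtP.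
rewrite count_cat inl0 add0n IHg -[inr m == _]/(m == j).
by case: (ltngtP m j) => ?; case: (ltnP j (m + _)) => ?; lia.
Qed.

(** * The Koszul complex of a set of commas *)

Section Koszul.
Variables (k : fieldType) (L : nat).
Implicit Types (c : {set 'I_L} -> k) (i j : 'I_L) (I J : {set 'I_L}).

Definition koszul_sign j I : k := (-1) ^+ #|[set t in I | (t < j)%N]|.

(** The sign may be read in [J] instead of [J :\ j], since [j] itself is not counted. *)
Definition koszul c J := \sum_(j in J) koszul_sign j J * c (J :\ j).

Lemma koszul_signK j I : koszul_sign j I * koszul_sign j I = 1.
Proof. by rewrite -expr2 sqrr_sign. Qed.

Lemma koszul_signU1 i j I : i \notin I ->
  koszul_sign j (i |: I) = (-1) ^+ (i < j)%N * koszul_sign j I.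
Proof.
move=> niI; rewrite /koszul_sign -exprD; congr (_ ^+ _).
rewrite (cardsD1 i) !inE eqxx /=; congr (_ + _)%N; apply: eq_card => t.
by rewrite !inE; case: eqVneq => // ->; rewrite (negPf niI).
Qed.

Lemma koszul_signD1 i j J : i \in J ->
  koszul_sign j J = (-1) ^+ (i < j)%N * koszul_sign j (J :\ i).
Proof. by move=> iJ; rewrite -{1}(setD1K iJ) koszul_signU1 // setD11. Qed.

Lemma koszul_ext c c' J : (forall j, j \in J -> c (J :\ j) = c' (J :\ j)) ->
  koszul c J = koszul c' J.
Proof. by move=> e; apply: eq_bigr => j /e ->. Qed.

Lemma koszulK c J : koszul (koszul c) J = 0.
Proof.
(* Delete [i], then [j]. The other order has the opposite sign: deleting the smaller index flips the
   sign of the larger one, but not conversely. *)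
pose F i j := koszul_sign i J * (koszul_sign j (J :\ i) * c (J :\ i :\ j)).
have Fanti i j : i \in J -> j \in J -> (i < j)%N -> F i j + F j i = 0.
  move=> iJ jJ lt; have ne : i != j by rewrite -val_eqE neq_ltn lt.
  have lt' : (j < i)%N = false by rewrite ltnNge ltnW.
  rewrite /F (koszul_signD1 i jJ) (koszul_signD1 j iJ) lt lt' expr0 expr1.
  rewrite !setDDl [[set j] :|: _]setUC; ring.
have -> : koszul (koszul c) J = \sum_(i in J) \sum_(j in J | j != i) F i j.
  apply: eq_bigr => i _; rewrite /koszul mulr_sumr; apply: eq_bigl => j.
  by rewrite !inE andbC.
have split_lt i : \sum_(j in J | j != i) F i j =
    \sum_(j in J | (i < j)%N) F i j + \sum_(j in J | (j < i)%N) F i j.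
  rewrite (bigID (fun j : 'I_L => (i < j)%N)) /=; congr (_ + _);
    apply: eq_bigl => j; rewrite -val_eqE; case: (j \in J) => //=; lia.
rewrite (eq_bigr _ (fun i _ => split_lt i)) big_split /=.
rewrite [X in _ + X](exchange_big_dep (mem J)) /=; last by move=> ? ? _ /andP[].
rewrite -big_split big1 //= => i iJ.
rewrite [X in _ + X](eq_bigl (fun j => (j \in J) && (i < j)%N)); last first.
  by move=> j /=; rewrite iJ.
by rewrite -big_split big1 //= => j /andP[jJ lt]; apply: Fanti.
Qed.

Definition koszul_homotopy j0 c I : k :=
  if j0 \in I then 0 else koszul_sign j0 I * c (j0 |: I).

(** Deleting any [j] other than [j0] leaves [j0] in the set, where the homotopy vanishes; only the
    term at [j0] survives. *)
Lemma koszul_homotopy_in j0 c J : j0 \in J ->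
  koszul (koszul_homotopy j0 c) J = c J.
Proof.
move=> j0J; rewrite /koszul (bigD1 j0) //= big1 => [|j /andP[_ ne]].
  rewrite addr0 /koszul_homotopy setD11 setD1K // mulrA (koszul_signD1 _ j0J).
  by rewrite ltnn mul1r koszul_signK mul1r.
by rewrite /koszul_homotopy !inE eq_sym ne j0J mulr0.
Qed.

(** This is the homotopy identity dh + hd = id at [J]: up to sign, the term hd is the value of
    [koszul c] at [j0 |: J], assumed to be 0. *)
Lemma koszul_homotopy_notin j0 c J : j0 \notin J -> koszul c (j0 |: J) = 0 ->
  koszul (koszul_homotopy j0 c) J = c J.
Proof.
move=> nj0J; rewrite /koszul big_setU1 //= setU1K // koszul_signU1 // ltnn mul1r.
move/eqP; rewrite addr_eq0 => /eqP e.
rewrite -[RHS]mul1r -(koszul_signK j0 J) -mulrA e -sumrN mulr_sumr.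
apply: eq_bigr => j jJ; have ne : j0 != j by apply: contraNneq nj0J => ->.
rewrite /koszul_homotopy !inE (negPf nj0J) andbF.
rewrite koszul_signU1 // (koszul_signD1 j0 jJ).
have -> : (j0 |: J) :\ j = j0 |: (J :\ j).
  apply/setP => t; rewrite !inE; case: (eqVneq t j) => // ->.
  by rewrite eq_sym (negPf ne).
(* Exactly one of the two inequalities holds, which produces the minus sign. *)
have : (j0 < j)%N + (j < j0)%N = 1%N :> nat.
  by case: ltngtP ne => // /val_inj ->; rewrite eqxx.
by case: (j0 < j)%N; case: (j < j0)%N => //= _; rewrite ?expr1 ?expr0; ring.
Qed.

End Koszul.

(** * The ribbon complex *)

Section Coefficients.
Variables (k : fieldType) (n : nat) (D : diagram).
Implicit Types (f g : {ffun syt n D -> k^o}) (T : {perm 'I_n}).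

(** Coordinates are indexed by all permutations, with value 0 off the standard fillings, so that one
    filling can be followed through all shapes. *)
Definition coef T f : k := oapp f 0 (insub T).

Lemma coef_val f t : coef (val t) f = f t.
Proof. by rewrite /coef valK. Qed.

Lemma coef_nstandard f T : ~~ standard D T -> coef T f = 0.
Proof. by move=> nst; rewrite /coef insubN. Qed.

Lemma coef0 T : coef T 0 = 0.
Proof. by rewrite /coef; case: insub => [t|] //=; rewrite ffunE. Qed.

Lemma coefN T f : coef T (- f) = - coef T f.
Proof. by rewrite /coef; case: insub => [t|] /=; rewrite ?ffunE ?oppr0. Qed.

Lemma coefD T f g : coef T (f + g) = coef T f + coef T g.
Proof. by rewrite /coef; case: insub => [t|] /=; rewrite ?ffunE ?addr0. Qed.

Lemma coef_sum T (X : Type) (r : seq X) (P : pred X) F :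
  coef T (\sum_(x <- r | P x) F x) = \sum_(x <- r | P x) coef T (F x).
Proof. exact: (big_morph _ (coefD T) (coef0 T)). Qed.

Lemma coefZ T a f : coef T (a *: f) = a * coef T f.
Proof. by rewrite /coef; case: insub => [t|] /=; rewrite ?ffunE ?mulr0. Qed.

Lemma coef_tab_vec T U :
  coef U (tab_vec k D T) = if standard D U then (T == U)%:R else 0.
Proof.
case: ifPn => [stU|]; last exact: coef_nstandard.
by rewrite -[U]/(val (Sub U stU : syt n D)) coef_val ffunE.
Qed.

Lemma coef_inj f g : coef^~ f =1 coef^~ g -> f = g.
Proof. by move=> e; apply/ffunP => t; rewrite -!coef_val e. Qed.

End Coefficients.

Lemma coef_transfer (k : fieldType) n D E (f : {ffun syt n D -> k^o}) T :
  coef T (transfer E f) = if standard E T then coef T f else 0.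
Proof.
case: ifPn => [stE|]; last exact: coef_nstandard.
rewrite [f in RHS]tab_vec_span /transfer !coef_sum.
apply: eq_bigr => U _; rewrite !coefZ; congr (_ * _).
rewrite !coef_tab_vec stE; case: ifPn => // nst.
by case: eqP nst => // <-; rewrite (valP U).
Qed.

(** * Standard fillings of the ribbon shapes in terms of ascents at the commas *)

Section Shapes.
Variables (n : nat) (alpha : seq (seq nat)).
Hypotheses (alpha_comp : all is_composition alpha)
           (alpha_size : sumn (map sumn alpha) = n).
Local Notation comma := 'I_(size alpha).-1.
Implicit Types (I J : {set comma}) (T : {perm 'I_n}) (i : 'I_n.-1) (j : comma).

(** There are [n - 1] labels, so the default is never reached. *)
Definition label_at i : label := nth (inl east) (labels alpha) i.

Definition proper_step (s : step) : bool := s.1 || s.2.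

Lemma ribbon_steps_proper a : all proper_step (ribbon_steps a).
Proof.
elim: a => //= m a IHa; rewrite all_cat all_nseq orbT /=.
by case: a IHa.
Qed.

Lemma labels_proper phi : (forall j : nat, proper_step (phi j)) ->
  all proper_step (map (fill phi) (labels alpha)).
Proof.
move=> ok; case: (alpha) => //= a g; rewrite map_cat map_fill_inl all_cat.
rewrite ribbon_steps_proper /=; elim: g 0%N => //= b g IHg m.
by rewrite ok map_cat map_fill_inl all_cat ribbon_steps_proper IHg.
Qed.

Lemma follows_labels D phi : (forall j : nat, proper_step (phi j)) ->
  (alpha != [::] -> D = walk (0, 0)%N (map (fill phi) (labels alpha))) ->
  follows D (fun i => fill phi (label_at i)).
Proof.
move=> ok eD i; have lti : (i < size (labels alpha))%N.
  by rewrite size_labels // alpha_size.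
(* The index [i] forces [n > 1], which excludes the empty sequence. *)
have nonnil : alpha != [::].
  apply/eqP => e; have := ltn_ord i; have := alpha_size; rewrite e /=; lia.
rewrite /label_at -(nth_map _ east) //; split.
  apply: (all_nthP _ (labels_proper ok)); by rewrite size_map.
by rewrite eD // -cell_at_walkS // size_map.
Qed.

Definition shape_fill I (j : nat) : step :=
  if nth false [seq t \in I | t <- enum comma] j then east else northeast.

Lemma shape_fillE I j : shape_fill I j = if j \in I then east else northeast.
Proof.
by rewrite /shape_fill (nth_map j) ?size_enum_ord ?ltn_ord // nth_ord_enum.
Qed.

Lemma follows_shape I :
  follows (ribbon_shape I) (fun i => fill (shape_fill I) (label_at i)).
Proof.
apply: follows_labels => [j|nonnil]; first by rewrite /shape_fill; case: nth.
exact: Diag_glue_at.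
Qed.

Lemma follows_flatten :
  follows (Diag [:: flatten alpha]) (fun i => fill (fun=> north) (label_at i)).
Proof. by apply: follows_labels => // nonnil; apply: Diag_flatten. Qed.

Lemma label_comma_lt i (j : nat) : label_at i = inr j -> (j < (size alpha).-1)%N.
Proof.
move=> e; have : inr j \in labels alpha.
  by rewrite -e mem_nth // size_labels // alpha_size.
by rewrite -has_pred1 has_count count_inr_labels lt0b.
Qed.

Lemma label_comma_ex j : exists i, label_at i = inr (val j).
Proof.
have jin : inr (val j) \in labels alpha.
  rewrite -has_pred1 has_count count_inr_labels lt0b; exact: (ltn_ord j).
have := jin; rewrite -index_mem size_labels // alpha_size => lti.
by exists (Ordinal lti); rewrite /label_at /= nth_index.
Qed.

Lemma label_comma_inj i i' (j : nat) :
  label_at i = inr j -> label_at i' = inr j -> i = i'.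
Proof.
wlog ltii : i i' / (i < i')%N.
  move=> W e e'; case: (ltngtP i i') => [lt|lt|/val_inj//]; first exact: W.
  exact/esym/W.
move=> e e'; have := count_inr_labels alpha j.
have lti' : (i' < size (labels alpha))%N by rewrite size_labels // alpha_size.
(* Two positions would contribute one occurrence before [i'] and another from [i'] on, but the total
   count is at most 1. *)
have in1 : inr j \in take i' (labels alpha).
  by rewrite -e /label_at -(nth_take _ ltii) mem_nth // size_take lti' ltii.
have in2 : inr j \in drop i' (labels alpha).
  by rewrite (drop_nth (inl east)) // -/(label_at i') e' inE eqxx.
rewrite -[labels alpha](cat_take_drop i') count_cat.
move: in1 in2; rewrite -!has_pred1 !has_count => c1 c2 e3.
by have := leq_add c1 c2; rewrite e3; case: (j < _)%N.
Qed.

Definition interior T :=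
  [forall i, if label_at i is inl s then step_ok T i s else true].

(** The quantifier over [i] picks out the single position labelled by the comma [j]. *)
Definition ascents T : {set comma} :=
  [set j | [forall i, (label_at i == inr (val j)) ==> (T (entry i) < T (entryS i))%N]].

Lemma standard_shape I T :
  standard (ribbon_shape I) T = interior T && (I \subset ascents T).
Proof.
rewrite (standardE (follows_shape I)); apply/forallP/andP => [ok|[/forallP ok sub] i].
  split; first by apply/forallP => i; have := ok i; case: (label_at i).
  apply/subsetP => j jI; rewrite inE; apply/forallP => i; apply/implyP => /eqP e.
  by have := ok i; rewrite e /= shape_fillE jI => /andP[].
have := ok i; case e: (label_at i) => [//|j] _ /=; have lt := label_comma_lt e.
rewrite -[j]/(val (Ordinal lt)) shape_fillE; case: ifP => // jI.
have := subsetP sub _ jI; rewrite inE => /forallP/(_ i).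
by rewrite e eqxx /step_ok /= => ->.
Qed.

Lemma standard_flatten T :
  standard (Diag [:: flatten alpha]) T = interior T && (ascents T == set0).
Proof.
rewrite (standardE follows_flatten); apply/forallP/andP => [ok|[/forallP ok asc0] i].
  split; first by apply/forallP => i; have := ok i; case: (label_at i).
  apply/eqP/setP => j; rewrite !inE; apply/forallP => asc.
  have [i e] := label_comma_ex j; have := ok i; have := asc i.
  by rewrite e eqxx /step_ok /=; lia.
have := ok i; case e: (label_at i) => [//|j] _ /=; have lt := label_comma_lt e.
have : Ordinal lt \notin ascents T by rewrite (eqP asc0) inE.
rewrite inE => /forallPn[i']; rewrite negb_imply => /andP[/eqP e'].
(* The failing position must be [i], and there a non-ascent is a strict descent because [T] is
   injective. *)
rewrite (label_comma_inj e' e) -leqNgt /step_ok /= leq_eqVlt => /orP[|//].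
by rewrite val_eqE (inj_eq perm_inj) -val_eqE /= gtn_eqF.
Qed.

Lemma standard_shapeS I J T : I \subset J ->
  standard (ribbon_shape J) T -> standard (ribbon_shape I) T.
Proof.
by rewrite !standard_shape => sub /andP[-> sub']; rewrite (subset_trans sub).
Qed.

(** Enlarging the set of glued commas only turns northeast steps into east steps, as
    [transfer_linear] requires. *)
Lemma glue_map_linear (k : fieldType) I J :
  I \subset J -> linear (@glue_map k n alpha I J).
Proof.
move=> sub; apply: transfer_linear (follows_shape I) (follows_shape J) _ _ => i.
  case e: (label_at i) => [s|j] /=; first exact: implybb.
  have lt := label_comma_lt e; rewrite -[j]/(val (Ordinal lt)) !shape_fillE.
  by case: ifP => // ; case: ifP => // /(subsetP sub) ->.
case e: (label_at i) => [s|j] /=; first exact: implybb.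
by rewrite /shape_fill; do 2!case: nth.
Qed.

Lemma flatten_transfer_linear (k : fieldType) I :
  linear (@transfer n k (Diag [:: flatten alpha]) (ribbon_shape I)
    : tabmod k n _ -> tabmod k n _).
Proof.
apply: transfer_linear follows_flatten (follows_shape I) _ _ => i.
  by case: (label_at i) => [s|j] /=; rewrite ?implybb ?implybT.
by case: (label_at i) => [s|j] /=; rewrite ?implybb.
Qed.

(** * The differential in coordinates, and exactness in positive degrees *)

Section Complex.
Variables (k : fieldType).
Local Notation C := (ribbon_cochain k n alpha).
Implicit Types (d : nat).

Definition cochain_coef d (x : C d) I T : k :=
  oapp (fun I' : {I' : {set comma} | #|I'| == d} => coef T (x I')) 0 (insub I).

Lemma cochain_coef_val d (x : C d) (I : {I : {set comma} | #|I| == d}) T :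
  cochain_coef x (val I) T = coef T (x I).
Proof. by rewrite /cochain_coef valK. Qed.

Lemma cochain_coef_inj d (x y : C d) :
  (forall I T, cochain_coef x I T = cochain_coef y I T) -> x = y.
Proof.
by move=> e; apply/ffunP => I; apply: coef_inj => T; rewrite -!cochain_coef_val.
Qed.

Lemma cochain_coef0 d I T : cochain_coef (0 : C d) I T = 0.
Proof.
rewrite /cochain_coef; case: insub => //= I'; rewrite ffunE.
exact: coef0.
Qed.

Lemma cochain_coef_out d (x : C d) I T :
  ~~ (standard (ribbon_shape I) T && (#|I| == d)) -> cochain_coef x I T = 0.
Proof.
rewrite negb_and => /orP[nst|ncard]; last by rewrite /cochain_coef insubN.
by rewrite /cochain_coef; case: insubP => //= I' _ e; rewrite coef_nstandard ?e.
Qed.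

Definition mk_cochain d (c : {set comma} -> {perm 'I_n} -> k) : C d :=
  dsum_of (fun I : {I : {set comma} | #|I| == d} =>
    ([ffun t => c (val I) (val t)] : tabmod k n (ribbon_shape (val I)))).

Lemma mk_cochainE d c I T : standard (ribbon_shape I) T -> #|I| = d ->
  cochain_coef (mk_cochain d c) I T = c I T.
Proof.
move=> stT /eqP card; rewrite /cochain_coef insubT /= ffunE.
by rewrite -[T in LHS]/(val (Sub T stT : syt n (ribbon_shape I))) coef_val ffunE.
Qed.

(** The sign [sgn] lives in the Hecke algebra; being 1 or -1, it acts as the same sign in the
    field. *)
Lemma coef_sgn_scale D (j : comma) I (f : tabmod k n D) T :
  coef T (sgn k n j I *: f) = koszul_sign k j I * coef T f.
Proof.
rewrite /sgn /koszul_sign -signr_odd -[in RHS]signr_odd.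
case: (odd _); last by rewrite expr0 scale1r mul1r.
by rewrite expr1 scaleN1r mulN1r; exact: coefN.
Qed.

(** The differential acts on each filling separately: the only source for a comma [j] of [J] is
    [J :\ j], and [glue_map] keeps [T] because it is standard of shape [J]. *)
Lemma cochain_coef_codiff d (x : C d) J T :
  standard (ribbon_shape J) T -> #|J| = d.+1 ->
  cochain_coef (ribbon_codiff x) J T = koszul (fun I => cochain_coef x I T) J.
Proof.
move=> stT card; rewrite /cochain_coef insubT ?card //= => cardJ.
rewrite ffunE /= coef_sum /=.
under eq_bigr do rewrite coef_sum /=.
rewrite (exchange_big_dep xpredT) //= /koszul [RHS]big_mkcond /=.
apply: eq_bigr => j _; case: ifP => jJ; last first.
  by apply: big_pred0 => I; apply/negP => /andP[_ /eqP e]; rewrite -e setU11 in jJ.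
have cardD : #|J :\ j| == d.
  by move: card; rewrite (cardsD1 j) jJ add1n => -[->].
rewrite (big_pred1 (Sub (J :\ j) cardD)) => [|I]; last first.
  rewrite -(inj_eq val_inj).
  change ((j \notin val I) && (j |: val I == J) = (val I == J :\ j)).
  apply/andP/eqP => [[nj /eqP <-]|->]; first by rewrite setU1K.
  by rewrite setD11 setD1K.
rewrite coef_sgn_scale coef_transfer stT insubT /=.
by rewrite [in RHS](koszul_signD1 k j jJ) ltnn mul1r.
Qed.

(** Signs are central, so this holds over the noncommutative Hecke algebra. *)
Lemma sgn_scale_linear (M : lmodType (hecke k n)) j I :
  linear (fun v : M => sgn k n j I *: v).
Proof.
move=> h u v; rewrite scalerDr; congr (_ + _); rewrite /sgn -signr_odd.
by case: (odd _); rewrite ?expr0 ?scale1r // expr1 !scaleN1r scalerN.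
Qed.

Lemma ribbon_codiff_linear d : linear (@ribbon_codiff k n alpha d).
Proof.
move=> h x y; apply/ffunP => J; rewrite !ffunE scaler_sumr -big_split.
apply: eq_bigr => I _; rewrite scaler_sumr -big_split.
apply: eq_bigr => j /andP[_ /eqP eJ] /=; rewrite !ffunE glue_map_linear; last first.
  by rewrite -eJ subsetUr.
exact: sgn_scale_linear.
Qed.

Lemma ribbon_codiffK d (x : C d) : ribbon_codiff (ribbon_codiff x) = 0.
Proof.
apply: cochain_coef_inj => J T; rewrite cochain_coef0.
have [/andP[stT /eqP card]|] := boolP (standard (ribbon_shape J) T && (#|J| == d.+2));
  last exact: cochain_coef_out.
rewrite cochain_coef_codiff // -[RHS](koszulK (fun I => cochain_coef x I T) J).
apply: koszul_ext => j jJ; apply: cochain_coef_codiff.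
  by apply: standard_shapeS stT; apply: subD1set.
by move: card; rewrite (cardsD1 j) jJ => -[].
Qed.

Lemma ribbon_codiff_exact d (x : C d.+1) : ribbon_codiff x = 0 ->
  exists y, x = ribbon_codiff y.
Proof.
(* Each filling [T] gets its own direction of contraction: an ascent of [T], chosen independently of
   [I]. *)
move=> dx; pose c I T := if [pick j in ascents T] is Some j
  then koszul_homotopy j (fun I => cochain_coef x I T) I else 0.
exists (mk_cochain d c); apply: cochain_coef_inj => J T.
have [/andP[stT /eqP card]|nst] := boolP (standard (ribbon_shape J) T && (#|J| == d.+1));
  last by rewrite !cochain_coef_out.
rewrite cochain_coef_codiff //.
have := stT; rewrite standard_shape => /andP[intT sub].
have [j0 j0J] : exists j, j \in J by apply/card_gt0P; rewrite card.
transitivity (koszul (c^~ T) J); last first.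
  apply: koszul_ext => j jJ; rewrite mk_cochainE //.
    by apply: standard_shapeS stT; apply: subD1set.
  by move: card; rewrite (cardsD1 j) jJ => -[].
rewrite /c; case: pickP => [j jA|none]; last first.
  by have := none j0; rewrite (subsetP sub).
have [jJ|njJ] := boolP (j \in J); first by rewrite koszul_homotopy_in.
(* As [j] is an ascent, [T] remains standard when [j] is glued as well, so the cocycle condition
   applies at [j |: J]. *)
rewrite koszul_homotopy_notin // -cochain_coef_codiff ?dx ?cochain_coef0 //.
  by rewrite standard_shape intT subUset sub1set jA.
by rewrite cardsU1 njJ card.
Qed.

(** * The cocycles of degree zero *)

Local Notation flat := (Diag [:: flatten alpha]).

Definition flat_cochain (f : tabmod k n flat) : C 0%N :=
  dsum_of (fun I : {I : {set comma} | #|I| == 0%N} =>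
    (transfer (ribbon_shape (val I)) f : tabmod k n (ribbon_shape (val I)))).

Lemma flat_cochain_linear : linear flat_cochain.
Proof.
move=> h f g; apply/ffunP => I; rewrite !ffunE. exact: flatten_transfer_linear.
Qed.

Lemma cochain_coef_flat f I T :
  cochain_coef (flat_cochain f) I T =
  if standard (ribbon_shape I) T && (I == set0) then coef T f else 0.
Proof.
rewrite -cards_eq0; case: ifPn => [/andP[stT card]|]; last exact: cochain_coef_out.
by rewrite /cochain_coef insubT /= ffunE coef_transfer stT.
Qed.

Lemma flat_standard_shape0 T : 
  standard flat T -> standard (ribbon_shape (set0 : {set comma})) T.
Proof. by rewrite standard_flatten standard_shape sub0set => /andP[->]. Qed.

(** A filling that is standard with one comma glued has an ascent there, so it is not standard for
    the concatenation and has coefficient 0. *)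
Lemma flat_cochainK f : ribbon_codiff (flat_cochain f) = 0.
Proof.
apply: cochain_coef_inj => J T; rewrite cochain_coef0.
have [/andP[stT /eqP card]|] := boolP (standard (ribbon_shape J) T && (#|J| == 1%N));
  last exact: cochain_coef_out.
rewrite cochain_coef_codiff // /koszul big1 // => j jJ.
rewrite cochain_coef_flat coef_nstandard ?if_same ?mulr0 //.
rewrite standard_flatten negb_and; apply/orP; right; apply/set0Pn; exists j.
by move: stT; rewrite standard_shape => /andP[_ /subsetP]; apply.
Qed.

Definition flat_part (x : C 0%N) : tabmod k n flat :=
  [ffun t => cochain_coef x set0 (val t)].

Lemma flat_partE x T : standard flat T -> coef T (flat_part x) = cochain_coef x set0 T.
Proof. by move=> stT; rewrite -[T]/(val (Sub T stT : syt n flat)) coef_val ffunE. Qed.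

Lemma flat_cochain_part x : ribbon_codiff x = 0 -> flat_cochain (flat_part x) = x.
Proof.
move=> dx; apply: cochain_coef_inj => I T; rewrite cochain_coef_flat.
case: ifPn => [/andP[stT /eqP I0]|nst]; last by rewrite cochain_coef_out ?cards_eq0.
rewrite I0 in stT *; have [stF|nstF] := boolP (standard flat T); first exact: flat_partE.
rewrite coef_nstandard //; move: nstF; rewrite standard_flatten.
have := stT; rewrite standard_shape => /andP[intT _]; rewrite intT /=.
(* At an ascent [j], the differential at [[set j]] is, up to sign, the coefficient of [T], which
   must therefore vanish. *)
case/set0Pn=> j jA; have std1 : standard (ribbon_shape [set j]) T.
  by rewrite standard_shape intT sub1set.
have := cochain_coef_codiff x std1 (cards1 j); rewrite dx cochain_coef0 /koszul.
rewrite big_set1 setDv => /esym/eqP; rewrite mulf_eq0 signr_eq0 /= => /eqP //.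
Qed.

Lemma flat_part_cochain f : flat_part (flat_cochain f) = f.
Proof.
apply: coef_inj => T; have [stF|nstF] := boolP (standard flat T); last first.
  by rewrite !coef_nstandard.
by rewrite flat_partE // cochain_coef_flat eqxx (flat_standard_shape0 stF).
Qed.

End Complex.
End Shapes.

(** * Quotient modules and cohomology *)

Section Quotient.
Local Open Scope quotient_scope.
Variables (R : pzRingType) (V : lmodType R) (S : submodule V).

Lemma quotmod_pi_linear : linear (fun x : V => \pi_(quotmod S) x).
Proof.
move=> a x y; rewrite quotmod_piD; congr (_ + _).
exact: esym (quotmod_pi_scale S a x).
Qed.

Lemma quotmod_pi_eq (x y : V) :
  S (x - y) -> \pi_(quotmod S) x = \pi_(quotmod S) y.
Proof. by move=> Sxy; apply/eqP/quotmodP. Qed.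

Lemma quotmod_pi0 : \pi_(quotmod S) 0 = 0.
Proof. by apply: (addrI (\pi_(quotmod S) 0)); rewrite addr0 -quotmod_piD addr0. Qed.

Lemma quotmod_repr_pi (x : V) : S (repr (\pi_(quotmod S) x) - x).
Proof. by apply/quotmodP; rewrite reprK. Qed.

End Quotient.

Section CohomologyIso.
Variables (R : pzRingType) (C : cochain_complex R).
Local Open Scope quotient_scope.

Lemma cohomology_eq0 i :
  (forall x : C i.+1, codiff x = 0 -> exists y : C i, x = codiff y) ->
  forall h : cohomology C i.+1, h = 0.
Proof.
move=> ex h; rewrite -[h]reprK -[RHS]quotmod_pi0; apply: quotmod_pi_eq.
rewrite subr0; apply: ex; exact/boolp.asboolP/(valP (repr h)).
Qed.

(** In degree 0 only 0 is a coboundary, so the cohomology is the module of cocycles, which [u]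
    parametrizes with inverse [v]. *)
Lemma cohomology0_iso (M : lmodType R) (u : M -> C 0%N) (v : C 0%N -> M) :
  linear u -> (forall m, codiff (u m) = 0) -> cancel u v ->
  (forall x, codiff x = 0 -> u (v x) = x) ->
  exists f : {linear cohomology C 0%N -> M}, bijective f.
Proof.
move=> ulin du uK vK.
have cu m : u m \in submod_pred (cocycles C 0%N) by apply/boolp.asboolP.
pose g m : cohomology C 0%N := \pi_(quotmod (coboundaries C 0)) (Sub (u m) (cu m)).
pose f (h : cohomology C 0%N) : M := v (val (repr h)).
have glin : linear g.
  move=> a x y; rewrite /g -quotmod_pi_linear; congr (\pi_(_) _).
  by apply: val_inj; rewrite linearP !SubK ulin.
have gK : cancel g f.
  move=> m; rewrite /f -[RHS]uK; congr v.
  (* A representative differs from [u m] by a coboundary of degree 0, that is, by 0. *)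
  have e : val (repr (g m) - Sub (u m) (cu m)) = 0 :=
    @quotmod_repr_pi _ _ (coboundaries C 0%N) (Sub (u m) (cu m)).
  by move/eqP: e; rewrite raddfB subr_eq0 => /eqP.
have fK : cancel f g.
  move=> h; rewrite -[RHS]reprK /g /f; congr (\pi_(_) _); apply: val_inj.
  by rewrite SubK vK //; apply/boolp.asboolP/(valP (repr h)).
pose G := HB.pack_for {linear M -> cohomology C 0%N} g (GRing.isLinear.Build _ _ _ _ g glin).
(* Linearity of [f] is inherited from its inverse [g]. *)
have flin : linear f := can2_linear (f := G) gK fK.
pose F := HB.pack_for {linear cohomology C 0%N -> M} f
  (GRing.isLinear.Build _ _ _ _ f flin).
by exists F; exists g.
Qed.

End CohomologyIso.

Theorem theorem5p6 (k : fieldType) (n : nat) (alpha : seq (seq nat))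
    (alpha_comp : all is_composition alpha)
    (alpha_size : sumn (map sumn alpha) = n) :
  exists (dlin : forall i, linear (@ribbon_codiff k n alpha i))
         (dd0 : forall i x,
            ribbon_codiff (@ribbon_codiff k n alpha i x) = 0),
    let C := CochainComplex dlin dd0 in
    (forall i, (0 < i)%N -> forall h : cohomology C i, h = 0) /\
    (exists f : {linear cohomology C 0 -> tabmod k n (Diag [:: flatten alpha])},
       bijective f).
Proof.
exists (ribbon_codiff_linear alpha_comp alpha_size (k := k)).
exists (ribbon_codiffK alpha_comp alpha_size (k := k)) => C; split=> [[//|i] _|].
  by apply: cohomology_eq0; exact: ribbon_codiff_exact.
apply: (@cohomology0_iso _ C (tabmod k n (Diag [:: flatten alpha]))
  (@flat_cochain n alpha k) (@flat_part n alpha k)).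
- exact: flat_cochain_linear.
- exact: flat_cochainK.
- exact: flat_part_cochain.
- exact: flat_cochain_part.
Qed.
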